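(* For every integer $n\ge0$, the algebra $\mathcal{A}_\Lambda(n)$ is a non-trivial polynomial deformation of the Clifford--Weyl algebra $\mathcal{A}_0(n)\simeq\mathcal{C}(2n+1,2)$.
   Context: All algebras are unital associative over $\mathbb{C}$; $[a,b]_{\mathcal L}=ab-ba$. For $\lambda\in\mathbb{C}$, $\mathcal{A}_\lambda(n)$ is the algebra with generators $\omega_1,\dots,\omega_{2n+1},E_+,E_-$ and relations $[E_+,E_-]_{\mathcal L}=-\frac14+i^n\lambda\,\omega_1\cdots\omega_{2n+1}$, $\omega_j\omega_k+\omega_k\omega_j=2\delta_{jk}$, $E_\pm\omega_j=-\omega_jE_\pm$ ($1\le j,k\le 2n+1$). $\mathcal{A}_\Lambda(n)$ is the algebra with generators $\omega_1,\dots,\omega_{2n+1},E_+,E_-,\Lambda$, with $\Lambda$ central and the same relations with $\lambda$ replaced by $\Lambda$. $\mathcal{C}(2n+1,2)$ is the algebra with generators $\omega_1,\dots,\omega_{2n+1},p,q$ and relations $\omega_i\omega_j+\omega_j\omega_i=2\delta_{ij}$, $pq-qp=1$, $\omega_ip=-p\omega_i$, $\omega_iq=-q\omega_i$; it is identified with $\mathcal{A}_0(n)$ via $p=2E_-$, $q=2E_+$. A formal deformation of an algebra $A$ is an associative $\mathbb{C}[[\Lambda]]$-algebra structure on $A[[\Lambda]]$ with $a\star b=ab+\sum_{m\ge1}\Lambda^m\Omega_m(a,b)$ for $a,b\in A$, $\Omega_m:A\times A\to A$ bilinear. It is polynomial if for all $a,b\in A$ the sum is finite, so that it restricts to a $\mathbb{C}[\Lambda]$-algebra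 structure on $A[\Lambda]$; one then also calls $A[\Lambda]$ with this product a polynomial deformation of $A$ (here $\mathcal{A}_\Lambda(n)=\mathcal{A}_0(n)[\Lambda]$ as vector spaces). A deformation is non-trivial if it is not equivalent to the undeformed product, where an equivalence is an isomorphism of $\mathbb{C}[[\Lambda]]$-algebras which is the identity modulo $\Lambda$. *)

(* Defs.v *)
From HB Require Import structures.
From mathcomp Require Import all_boot all_order all_algebra.
From mathcomp Require Import boolp functions reals.
From mathcomp Require Import complex.
From mathcomp Require Import monalg.

Set Implicit Arguments.
Unset Strict Implicit.
Unset Printing Implicit Defensive.

Import GRing.Theory Num.Theory.

Local Open Scope ring_scope.
Local Open Scope quotient_scope.

(** * Unital associative algebras, possibly zero *)

(* MathComp's [algType] excludes the zero algebra, whereas an algebra given by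
   generators and relations is not known in advance to be nonzero. *)
Record pzAlg (K : pzRingType) := PzAlg {
  pz_ring : pzRingType;
  pz_scale : K -> pz_ring -> pz_ring;
  pz_scaleA : forall a b u, pz_scale a (pz_scale b u) = pz_scale (a * b) u;
  pz_scale1 : left_id 1 pz_scale;
  pz_scaleDr : right_distributive pz_scale +%R;
  pz_scaleDl : forall u, {morph pz_scale^~ u : a b / a + b};
  pz_scaleAl : forall a u v, pz_scale a (u * v) = pz_scale a u * v;
  pz_scaleAr : forall a u v, pz_scale a (u * v) = u * pz_scale a v
}.

Definition pz_carrier (K : pzRingType) (A : pzAlg K) : Type := pz_ring A.
Coercion pz_carrier : pzAlg >-> Sortclass.

HB.instance Definition _ K (A : pzAlg K) :=
  GRing.PzRing.copy (pz_carrier A) (pz_ring A).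
HB.instance Definition _ K (A : pzAlg K) :=
  GRing.Zmodule_isLmodule.Build K (pz_carrier A)
    (@pz_scaleA K A) (@pz_scale1 K A) (@pz_scaleDr K A) (@pz_scaleDl K A).

(** * Algebras given by generators and relations *)

(* The monoid algebra of the free (noncommutative) monoid {fmonom X}. *)
Definition free_alg (K : comNzRingType) (X : choiceType) : Type :=
  {malg K[{fmonom X}]}.

Definition gen (K : comNzRingType) (X : choiceType) (x : X) : free_alg K X :=
  << fmu x >>.

Section FreeAlgebra.
Variables (K : comNzRingType) (X : choiceType).

HB.instance Definition _ := GRing.Lalgebra.on (free_alg K X).

Fact free_alg_scaleAr (c : K) (u v : free_alg K X) :
  c *: (u * v) = u * (c *: v).
Proof.
have cC (w : {malg K[{fmonom X}]}) : w * c%:MP = c *: w.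
  rewrite malgM_def malgZ_def fgmulgU; apply: eq_bigr => k _.
  by rewrite mulm1 mulrC.
rewrite scalerAl; change ((c *: (u : {malg K[{fmonom X}]})) * v = u * (c *: v)).
by rewrite -cC -mulrA mul_malgC.
Qed.

HB.instance Definition _ :=
  GRing.Lalgebra_isAlgebra.Build K (free_alg K X) free_alg_scaleAr.

End FreeAlgebra.

(* The two-sided ideal generated by S; it is stable under opposites and scalars
   since these are multiplications by elements of A. *)
Inductive ideal_gen (A : pzRingType) (S : A -> Prop) : A -> Prop :=
| ideal_gen_mem x of S x : ideal_gen S x
| ideal_gen0 : ideal_gen S 0
| ideal_genD x y of ideal_gen S x & ideal_gen S y : ideal_gen S (x + y)
| ideal_genMl a x of ideal_gen S x : ideal_gen S (a * x)
| ideal_genMr a x of ideal_gen S x : ideal_gen S (x * a).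

Section QuotientAlgebra.
Variables (K : comNzRingType) (A : algType K) (S : A -> Prop).

Definition ideal_equiv (x y : A) : bool := `[< ideal_gen S (x - y) >].

Fact ideal_genN x : ideal_gen S x -> ideal_gen S (- x).
Proof. by move=> Sx; rewrite -mulN1r; apply: ideal_genMl. Qed.

Fact ideal_equiv_is_equiv : equiv_class_of ideal_equiv.
Proof.
split=> [x|x y|y x z].
- by apply/asboolP; rewrite subrr; apply: ideal_gen0.
- by apply/asboolP/asboolP => /ideal_genN; rewrite opprB.
- move=> /asboolP xy /asboolP yz; apply/asboolP.
  by rewrite -(subrKA y); apply: ideal_genD.
Qed.

Canonical ideal_equiv_equiv := EquivRelPack ideal_equiv_is_equiv.
Canonical ideal_equiv_encModRel := defaultEncModRel ideal_equiv.

Definition quot_type : Type := {eq_quot ideal_equiv}.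

HB.instance Definition _ := Choice.on quot_type.
HB.instance Definition _ := EqQuotient.on quot_type.

Definition quot_pi (x : A) : quot_type := \pi_{eq_quot ideal_equiv} x.

Fact quot_piP x y : quot_pi x = quot_pi y <-> ideal_gen S (x - y).
Proof.
split=> [/eqmodP /asboolP //|Sxy]; apply/eqmodP; exact/asboolP.
Qed.

Let qrepr (u : quot_type) : A := repr u.

Fact quot_reprK u : quot_pi (qrepr u) = u.
Proof. exact: reprK. Qed.

Fact quot_piW (P : quot_type -> Prop) :
  (forall x, P (quot_pi x)) -> forall u, P u.
Proof. by move=> h u; rewrite -(quot_reprK u). Qed.

Let repr_pi x : ideal_gen S (qrepr (quot_pi x) - x).
Proof. by apply/quot_piP; rewrite quot_reprK. Qed.

Definition quot_zero : quot_type := quot_pi 0.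
Definition quot_one : quot_type := quot_pi 1.
Definition quot_opp (u : quot_type) : quot_type := quot_pi (- qrepr u).
Definition quot_add (u v : quot_type) : quot_type := quot_pi (qrepr u + qrepr v).
Definition quot_mul (u v : quot_type) : quot_type := quot_pi (qrepr u * qrepr v).
Definition quot_scale (c : K) (u : quot_type) : quot_type :=
  quot_pi (c *: qrepr u).

Fact quot_oppE x : quot_opp (quot_pi x) = quot_pi (- x).
Proof. by apply/quot_piP; rewrite -opprD; apply/ideal_genN/repr_pi. Qed.

Fact quot_addE x y : quot_add (quot_pi x) (quot_pi y) = quot_pi (x + y).
Proof.
by apply/quot_piP; rewrite opprD addrACA; apply: ideal_genD; apply: repr_pi.
Qed.

Fact quot_mulE x y : quot_mul (quot_pi x) (quot_pi y) = quot_pi (x * y).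
Proof.
apply/quot_piP; rewrite -(subrKA (qrepr (quot_pi x) * y)) -mulrBr -mulrBl.
apply: ideal_genD.
  by apply: ideal_genMl; apply: repr_pi.
by apply: ideal_genMr; apply: repr_pi.
Qed.

Fact quot_scaleE c x : quot_scale c (quot_pi x) = quot_pi (c *: x).
Proof.
apply/quot_piP; rewrite -scalerBr -mulr_algl.
by apply: ideal_genMl; apply: repr_pi.
Qed.

Let qE := (quot_oppE, quot_addE, quot_mulE, quot_scaleE).

Fact quot_addA : associative quot_add.
Proof. by elim/quot_piW=> x; elim/quot_piW=> y; elim/quot_piW=> z; rewrite !qE addrA. Qed.
Fact quot_addC : commutative quot_add.
Proof. by elim/quot_piW=> x; elim/quot_piW=> y; rewrite !qE addrC. Qed.
Fact quot_add0 : left_id quot_zero quot_add.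
Proof. by elim/quot_piW=> x; rewrite !qE add0r. Qed.
Fact quot_addN : left_inverse quot_zero quot_opp quot_add.
Proof. by elim/quot_piW=> x; rewrite !qE addNr. Qed.

HB.instance Definition _ :=
  GRing.isZmodule.Build quot_type quot_addA quot_addC quot_add0 quot_addN.

Fact quot_mulA : associative quot_mul.
Proof. by elim/quot_piW=> x; elim/quot_piW=> y; elim/quot_piW=> z; rewrite !qE mulrA. Qed.
Fact quot_mul1 : left_id quot_one quot_mul.
Proof. by elim/quot_piW=> x; rewrite !qE mul1r. Qed.
Fact quot_1mul : right_id quot_one quot_mul.
Proof. by elim/quot_piW=> x; rewrite !qE mulr1. Qed.
Fact quot_mulDl : left_distributive quot_mul quot_add.
Proof. by elim/quot_piW=> x; elim/quot_piW=> y; elim/quot_piW=> z; rewrite !qE mulrDl. Qed.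
Fact quot_mulDr : right_distributive quot_mul quot_add.
Proof. by elim/quot_piW=> x; elim/quot_piW=> y; elim/quot_piW=> z; rewrite !qE mulrDr. Qed.

HB.instance Definition _ := GRing.Zmodule_isPzRing.Build quot_type
  quot_mulA quot_mul1 quot_1mul quot_mulDl quot_mulDr.

Fact quot_scaleA a b u : quot_scale a (quot_scale b u) = quot_scale (a * b) u.
Proof. by elim/quot_piW: u => x; rewrite !qE scalerA. Qed.
Fact quot_scale1 : left_id 1 quot_scale.
Proof. by elim/quot_piW=> x; rewrite !qE scale1r. Qed.
Fact quot_scaleDr : right_distributive quot_scale quot_add.
Proof. by move=> a; elim/quot_piW=> x; elim/quot_piW=> y; rewrite !qE scalerDr. Qed.
Fact quot_scaleDl u : {morph quot_scale^~ u : a b / a + b >-> quot_add a b}.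
Proof. by move=> a b; elim/quot_piW: u => x; rewrite !qE scalerDl. Qed.

Fact quot_scaleAl a (u v : quot_type) : quot_scale a (u * v) = quot_scale a u * v.
Proof.
rewrite /GRing.mul /=.
by elim/quot_piW: u => x; elim/quot_piW: v => y; rewrite !qE scalerAl.
Qed.
Fact quot_scaleAr a (u v : quot_type) : quot_scale a (u * v) = u * quot_scale a v.
Proof.
rewrite /GRing.mul /=.
by elim/quot_piW: u => x; elim/quot_piW: v => y; rewrite !qE scalerAr.
Qed.

Definition quot_alg : pzAlg K := PzAlg quot_scaleA quot_scale1 quot_scaleDr
  quot_scaleDl quot_scaleAl quot_scaleAr.

End QuotientAlgebra.

Definition presented_alg (K : comNzRingType) (X : choiceType)
    (S : free_alg K X -> Prop) : pzAlg K := quot_alg S.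

Definition pgen (K : comNzRingType) (X : choiceType)
    (S : free_alg K X -> Prop) (x : X) : presented_alg S := quot_pi S (gen K x).

(** * The Clifford-Weyl algebra C(2n+1,2) and the algebras A_lambda, A_Lambda *)

(* A relation l = r is recorded by its relator l - r. *)

Section Algebras.
Variables (R : realType) (n : nat).
Local Notation C := (complex R).
Local Notation m := (2 * n + 1)%N.

Inductive cliffWeyl_rel (F : algType C) (w : 'I_m -> F) (p q : F) : F -> Prop :=
| cliffWeyl_clifford j k :
    cliffWeyl_rel w p q (w j * w k + w k * w j - 2%:R *+ (j == k))
| cliffWeyl_weyl : cliffWeyl_rel w p q (p * q - q * p - 1)
| cliffWeyl_omega_p j : cliffWeyl_rel w p q (w j * p - - (p * w j))
| cliffWeyl_omega_q j : cliffWeyl_rel w p q (w j * q - - (q * w j)).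

Inductive A_rel (F : algType C) (w : 'I_m -> F) (Ep Em L : F) : F -> Prop :=
| A_commutator : A_rel w Ep Em L
    (Ep * Em - Em * Ep
       - (- (4%:R^-1)%:A + 'i ^+ n *: (L * \prod_(j < m) w j)))
| A_clifford j k :
    A_rel w Ep Em L (w j * w k + w k * w j - 2%:R *+ (j == k))
| A_plus j : A_rel w Ep Em L (Ep * w j - - (w j * Ep))
| A_minus j : A_rel w Ep Em L (Em * w j - - (w j * Em)).

Inductive ALambda_rel (F : algType C) (w : 'I_m -> F) (Ep Em L : F) : F -> Prop :=
| ALambda_A x of A_rel w Ep Em L x : ALambda_rel w Ep Em L x
| ALambda_central x : ALambda_rel w Ep Em L (L * x - x * L).

(* [inl j] is omega_(j+1); [inr true], [inr false] are p, q, resp. E_+, E_-;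
   in A_Lambda, [None] is Lambda. *)
Let X : choiceType := ('I_m + bool)%type.
Let XL : choiceType := option X.

Definition cliffWeyl_relators : free_alg C X -> Prop :=
  cliffWeyl_rel (fun j => gen C (inl j : X)) (gen C (inr true : X))
    (gen C (inr false : X)).

Definition A_relators (lam : C) : free_alg C X -> Prop :=
  A_rel (fun j => gen C (inl j : X)) (gen C (inr true : X))
    (gen C (inr false : X)) lam%:A.

Definition ALambda_relators : free_alg C XL -> Prop :=
  ALambda_rel (fun j => gen C (Some (inl j) : XL)) (gen C (Some (inr true) : XL))
    (gen C (Some (inr false) : XL)) (gen C (None : XL)).

Definition cliffWeyl : pzAlg C := presented_alg cliffWeyl_relators.
Definition cliffWeyl_omega (j : 'I_m) : cliffWeyl := pgen _ (inl j : X).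
Definition cliffWeyl_p : cliffWeyl := pgen _ (inr true : X).
Definition cliffWeyl_q : cliffWeyl := pgen _ (inr false : X).

Definition A_ (lam : C) : pzAlg C := presented_alg (A_relators lam).
Definition A_omega lam (j : 'I_m) : A_ lam := pgen _ (inl j : X).
Definition A_Eplus lam : A_ lam := pgen _ (inr true : X).
Definition A_Eminus lam : A_ lam := pgen _ (inr false : X).

Definition ALambda : pzAlg C := presented_alg ALambda_relators.
Definition ALambda_omega (j : 'I_m) : ALambda := pgen _ (Some (inl j) : XL).
Definition ALambda_Eplus : ALambda := pgen _ (Some (inr true) : XL).
Definition ALambda_Eminus : ALambda := pgen _ (Some (inr false) : XL).
Definition ALambda_Lambda : ALambda := pgen _ (None : XL).

End Algebras.

(** * Formal deformations *)

Section Deformation.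
Variables (K : comNzRingType) (A : pzAlg K).

(* A[[Lambda]]: the value at k is the coefficient of Lambda^k. *)
Definition pseries (V : Type) : Type := nat -> V.
HB.instance Definition _ (V : lmodType K) := GRing.Lmodule.copy (pseries V) (nat -> V).

Implicit Types f g : pseries A.

Definition ps_const (a : A) : pseries A := fun k => if k == 0%N then a else 0.

Definition ps_scale (c : pseries K) f : pseries A :=
  fun k => \sum_(i < k.+1) c i *: f (k - i)%N.

Definition ps_Lambda : pseries K := fun k => (k == 1%N)%:R.

(* The undeformed product of A[[Lambda]]. *)
Definition ps_mul f g : pseries A :=
  fun k => \sum_(i < k.+1) f i * g (k - i)%N.

Definition ps_is_poly f : Prop := exists N, forall k, (N <= k)%N -> f k = 0.

(* K[[Lambda]]-linearity, not merely K-linearity. *)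
Definition ps_linear (T : pseries A -> pseries A) : Prop :=
  forall (c : pseries K) f g, T (ps_scale c f + g) = ps_scale c (T f) + T g.

(* Omega_k (a, b) is [star (ps_const a) (ps_const b) k]; it is bilinear because
   star is K[[Lambda]]-bilinear. *)
Record formal_deformation (star : pseries A -> pseries A -> pseries A) : Prop :=
  FormalDeformation {
    deformation_linearl : forall g, ps_linear (star^~ g);
    deformation_linearr : forall f, ps_linear (star f);
    deformation_assoc : associative star;
    deformation_unit :
      exists e : pseries A, left_id e star /\ right_id e star;
    deformation_mod : forall a b : A,
      star (ps_const a) (ps_const b) 0%N = a * b
  }.

Definition polynomial_deformation (star : pseries A -> pseries A -> pseries A) :=
  formal_deformation star /\
  forall a b : A, ps_is_poly (star (ps_const a) (ps_const b)).

Definition deformation_equiv (star1 star2 : pseries A -> pseries A -> pseries A) :=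
  exists T : pseries A -> pseries A,
    [/\ ps_linear T, bijective T,
        forall f g, T (star1 f g) = star2 (T f) (T g)
      & forall f, T f 0%N = f 0%N].

Definition nontrivial_deformation (star : pseries A -> pseries A -> pseries A) :=
  ~ deformation_equiv star ps_mul.

(* phi is an isomorphism of unital K[Lambda]-algebras from B, on which Lambda
   acts as multiplication by the central element L, onto the polynomial part
   A[Lambda] of (A[[Lambda]], star). *)
Record iso_poly_part (star : pseries A -> pseries A -> pseries A)
    (B : pzAlg K) (L : B) (phi : {linear B -> pseries A}) : Prop :=
  IsoPolyPart {
    iso_poly_inj : injective phi;
    iso_poly_image : forall f, ps_is_poly f <-> exists x, phi x = f;
    iso_poly_mul : forall x y, phi (x * y) = star (phi x) (phi y);
    iso_poly_one : phi 1 = ps_const 1;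
    iso_poly_Lambda : forall x, phi (L * x) = ps_scale ps_Lambda (phi x)
  }.

End Deformation.

(* Main.v *)
(* As a left module over the Clifford algebra Cl, A_0 has the basis
   E_+^a E_-^b: this is seen on its action on Cl-valued functions of (a, b).
   Let A_Lambda act on A_0[[Lambda]] by letting E_- act as E_- + Lambda D, where
   D is a Dunkl-type divided difference in E_+. Then x |-> x . 1 identifies
   A_Lambda with A_0[Lambda], its inverse being f |-> sum_k Lambda^k sec(f_k),
   where sec : A_0 -> A_Lambda preserves the ordered monomials. The product of
   A_Lambda is thereby transported to A_0[Lambda], and it extends to A_0[[Lambda]]
   since the k-th coefficient of f * g depends on f and g modulo Lambda^(k+1) only.

   An equivalence with the undeformed product would, in degree one in Lambda,
   exhibit i^n omega_1 ... omega_(2n+1) as a sum of commutators of A_0. But A_0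
   has a trace (the supertrace of the Weyl algebra twisted by a trace of the
   Clifford algebra) that does not vanish on this element. *)

Require Import Defs.
From HB Require Import structures.
From mathcomp Require Import all_boot all_order all_algebra.
From mathcomp Require Import finmap boolp functions reals.
From mathcomp Require Import complex.
From mathcomp Require Import monalg.

Set Implicit Arguments.
Unset Strict Implicit.
Unset Printing Implicit Defensive.

Import GRing.Theory Num.Theory.

Local Open Scope ring_scope.

(** The quotients come with no normal form, so linear independence can only be read off modules.
    Each presentation is therefore reduced to a record: generation, relations, and the fact that
    operators satisfying the relations form a module. C(2n+1,2) satisfies the same record as A_0
    after the rescaling E_+ = q/2, E_- = p/2, whence their isomorphism. Parity drives the rest.
    Since 2n+1 is odd, the volume element is central in Cl but odd under the parity involution [s],
    so it anticommutes with E_+. The correction that E_- picks up when it crosses E_+^a is then an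
    alternating sum: one term for odd a, none for even a. This is the origin of D. Parity also makes
    the trace possible. As 1 = 4 [E_-, E_+] is a commutator, a trace on A_0 must kill 1 and yet see
    the volume element. Choosing the trace on Cl odd under [s] separates the two, and the resulting
    sign replaces a trace on the Weyl algebra, where every trace vanishes, by a supertrace. *)

Definition linear_of (K : pzRingType) (U V : lmodType K) (f : U -> V)
    (fL : linear f) : {linear U -> V} :=
  HB.pack f (GRing.isLinear.Build K U V *:%R f fL).

Lemma linear0_of (K : pzRingType) (U V : lmodType K) (f : U -> V) :
  linear f -> f 0 = 0.
Proof. by move=> fL; apply: (linear0 (linear_of fL)). Qed.

Lemma pz_mulAl (K : pzRingType) (A : pzAlg K) (c : K) (u v : A) :
  (c *: u) * v = c *: (u * v).
Proof. exact: (esym (pz_scaleAl _ _ _)). Qed.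

Lemma pz_mulAr (K : pzRingType) (A : pzAlg K) (c : K) (u v : A) :
  u * (c *: v) = c *: (u * v).
Proof. exact: (esym (pz_scaleAr _ _ _)). Qed.

(** * Actions of free algebras *)

Section FreeAction.
Variables (K : comNzRingType) (X : choiceType).
Local Notation F := (free_alg K X).

Definition free_mon (s : seq X) : F := << FMonom s >>.

Lemma free_mon_nil : free_mon [::] = 1.
Proof. by rewrite /free_mon -fmoneE. Qed.

Lemma free_mon_cons g s : free_mon (g :: s) = gen K g * free_mon s.
Proof.
change (<< FMonom (g :: s) >> =
        << fmu g >> * << FMonom s >> :> {malg K[{fmonom X}]}).
rewrite malgM_def fgmulUU mulr1; congr (<< _ *g _ >>).
by apply/eqP; rewrite fmP fmM fmU.
Qed.

Lemma free_monW (P : F -> Prop) :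
  P 0 -> (forall c s x, P x -> P (c *: free_mon s + x)) -> forall x, P x.
Proof.
move=> P0 PD x; rewrite (monalgE x).
elim: (enum_fset (msupp x)) => [|k r IH]; first by rewrite big_nil.
rewrite big_cons; have -> : << x@_k *g k >> = x@_k *: free_mon k.
  apply/malgP => l; rewrite /free_mon fmK [RHS](mcoeffZ x@_k) !mcoeffU.
  by rewrite mulr_natr.
exact: PD.
Qed.

Lemma free_algW (P : F -> Prop) :
    P 1 -> (forall c x y, P x -> P y -> P (c *: x + y)) ->
    (forall g x, P x -> P (gen K g * x)) ->
  forall x, P x.
Proof.
move=> P1 PD PM; apply: free_monW => [|c s x Px].
  by rewrite -(addNr 1) -scaleN1r; apply: PD.
apply: PD => //; elim: s => [|g s IH]; first by rewrite free_mon_nil.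
by rewrite free_mon_cons; apply: PM.
Qed.

Variables (W : lmodType K) (op : X -> W -> W).
Hypothesis op_linear : forall g, linear (op g).

Definition free_act (x : F) (v : W) : W :=
  \sum_(k <- msupp x) x@_k *: foldr op v (k : seq X).

Lemma free_actEw (d : {fset {fmonom X}}) x v : (msupp x `<=` d)%fset ->
  free_act x v = \sum_(k <- d) x@_k *: foldr op v (k : seq X).
Proof.
move=> sxd; rewrite /free_act (big_fset_incl _ sxd) //= => k _ kx.
by rewrite mcoeff_outdom // scale0r.
Qed.

Lemma free_act_linearl v : linear (free_act^~ v).
Proof.
move=> c x y; set d := (msupp x `|` msupp y `|` msupp (c *: x + y))%fset.
have sx : (msupp x `<=` d)%fset by rewrite /d -fsetUA fsubsetUl.
have sy : (msupp y `<=` d)%fset by rewrite /d fsetUAC fsubsetUr.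
rewrite /= (free_actEw v sx) (free_actEw v sy) (@free_actEw d) ?fsubsetUr //.
rewrite scaler_sumr -big_split /=; apply: eq_bigr => k _.
by rewrite mcoeffD [X in X + _](mcoeffZ c) scalerDl scalerA.
Qed.

Lemma free_act_mon s v : free_act (free_mon s) v = foldr op v s.
Proof.
rewrite /free_act msuppU oner_eq0 big_seq_fset1.
by rewrite (mcoeffUU (FMonom s) (1 : K)) scale1r.
Qed.

Lemma free_act1 v : free_act 1 v = v.
Proof. by rewrite -free_mon_nil free_act_mon. Qed.

Lemma free_act_genM g x v : free_act (gen K g * x) v = op g (free_act x v).
Proof.
have lin0 : free_act 0 v = 0 by apply: (linear0_of (free_act_linearl v)).
elim/free_monW: x => [|c s x IH].
  by rewrite mulr0 lin0 (linear0_of (op_linear g)).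
rewrite (free_act_linearl v) op_linear -IH mulrDr -scalerAr -free_mon_cons.
by rewrite (free_act_linearl v) !free_act_mon.
Qed.

End FreeAction.

(* The two records only differ in the kind of algebra that acts: [algType]
   excludes the zero algebra and [pzAlg] does not. *)
Record alg_action (K : comNzRingType) (F : algType K) (W : lmodType K) :=
  AlgAction {
    alg_act :> F -> W -> W;
    alg_act_linearl : forall v, linear (alg_act^~ v);
    alg_act_linearr : forall x, linear (alg_act x);
    alg_act1 : forall v, alg_act 1 v = v;
    alg_actM : forall x y v, alg_act (x * y) v = alg_act x (alg_act y v)
  }.

Record action (K : comNzRingType) (B : pzAlg K) (W : lmodType K) := Action {
  act :> B -> W -> W;
  act_linearl : forall v, linear (act^~ v);
  act_linearr : forall x, linear (act x);
  act1 : forall v, act 1 v = v;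
  actM : forall x y v, act (x * y) v = act x (act y v)
}.

Section AlgActionTheory.
Variables (K : comNzRingType) (F : algType K) (W : lmodType K).
Variable a : alg_action F W.

Lemma alg_actDl x y v : a (x + y) v = a x v + a y v.
Proof. exact: (raddfD (linear_of (alg_act_linearl a v))). Qed.
Lemma alg_actNl x v : a (- x) v = - a x v.
Proof. exact: (raddfN (linear_of (alg_act_linearl a v))). Qed.
Lemma alg_act0l v : a 0 v = 0.
Proof. exact: (raddf0 (linear_of (alg_act_linearl a v))). Qed.
Lemma alg_actZl c x v : a (c *: x) v = c *: a x v.
Proof. exact: (linearZ_LR (linear_of (alg_act_linearl a v))). Qed.
Lemma alg_actMnl x i v : a (x *+ i) v = a x v *+ i.
Proof. exact: (raddfMn (linear_of (alg_act_linearl a v))). Qed.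
Lemma alg_act0r x : a x 0 = 0.
Proof. exact: (linear0_of (alg_act_linearr a x)). Qed.

Lemma alg_act_prod (I : Type) (r : seq I) (f : I -> F) v :
  a (\prod_(i <- r) f i) v = foldr (fun i => a (f i)) v r.
Proof.
elim: r => [|i r IH]; first by rewrite big_nil alg_act1.
by rewrite big_cons alg_actM IH.
Qed.

Definition alg_actE := (alg_actDl, alg_actNl, alg_act0l, alg_actZl, alg_actMnl,
  alg_act1, alg_actM, alg_act_prod).

(** Right multiples force the induction to range over all vectors: [x * z] acts on [v] as [x] acts
    on the image of [v] under [z]. *)
Lemma ideal_act0 (S : F -> Prop) : (forall r v, S r -> a r v = 0) ->
  forall r v, ideal_gen S r -> a r v = 0.
Proof.
move=> S0 r v Sr; elim: Sr v => [x Sx||x y _ IHx _ IHy|z x _ IH|z x _ IH] v.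
- exact: S0.
- exact: alg_act0l.
- by rewrite alg_actDl IHx IHy addr0.
- by rewrite alg_actM IH alg_act0r.
- by rewrite alg_actM IH.
Qed.

End AlgActionTheory.

Section ActionTheory.
Variables (K : comNzRingType) (B : pzAlg K) (W : lmodType K) (a : action B W).

Lemma actDl x y v : a (x + y) v = a x v + a y v.
Proof. exact: (raddfD (linear_of (act_linearl a v))). Qed.
Lemma actZl c x v : a (c *: x) v = c *: a x v.
Proof. exact: (linearZ_LR (linear_of (act_linearl a v))). Qed.
Lemma act_suml I (r : seq I) (P : pred I) (f : I -> B) v :
  a (\sum_(i <- r | P i) f i) v = \sum_(i <- r | P i) a (f i) v.
Proof. exact: (raddf_sum (linear_of (act_linearl a v))). Qed.

End ActionTheory.

Section GeneratedAction.
Variables (K : comNzRingType) (X : Type) (F : algType K) (gn : X -> F).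
Hypothesis genW : forall P : F -> Prop,
    P 1 -> (forall c x y, P x -> P y -> P (c *: x + y)) ->
    (forall g x, P x -> P (gn g * x)) ->
  forall x, P x.
Variables (W : lmodType K) (op : X -> W -> W) (a : F -> W -> W).
Hypothesis op_linear : forall g, linear (op g).
Hypothesis a_linear : forall v, linear (a^~ v).
Hypothesis a1 : forall v, a 1 v = v.
Hypothesis a_genM : forall g x v, a (gn g * x) v = op g (a x v).

Lemma gen_actM x y v : a (x * y) v = a x (a y v).
Proof.
elim/genW: x => [|c x z IHx IHz|g x IH].
- by rewrite mul1r a1.
- by rewrite mulrDl -scalerAl !(a_linear v) !(a_linear (a y v)) IHx IHz.
- by rewrite -mulrA !a_genM IH.
Qed.

Lemma gen_act_linearr x : linear (a x).
Proof.
move=> c u v; elim/genW: x => [|d x y IHx IHy|g x IH].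
- by rewrite !a1.
- rewrite !(a_linear (c *: u + v)) !(a_linear u) !(a_linear v) IHx IHy.
  by rewrite !scalerDr !scalerA (mulrC d) addrACA.
- by rewrite !a_genM IH op_linear.
Qed.

Definition gen_action : alg_action F W :=
  AlgAction a_linear gen_act_linearr a1 gen_actM.

Lemma gen_actionE g v : gen_action (gn g) v = op g v.
Proof. by rewrite /= -(mulr1 (gn g)) a_genM a1. Qed.

End GeneratedAction.

Section QuotientAction.
Variables (K : comNzRingType) (F : algType K) (S : F -> Prop).
Local Notation B := (quot_alg S).

Definition quot_proj (x : F) : B := quot_pi S x.

Lemma quot_proj_linear : linear quot_proj.
Proof. by move=> c x y; rewrite /quot_proj -quot_addE -quot_scaleE. Qed.

Lemma quot_proj_monoid_morphism : monoid_morphism quot_proj.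
Proof. by split=> // x y; exact/esym/quot_mulE. Qed.

HB.instance Definition _ :=
  GRing.isLinear.Build K F B _ quot_proj quot_proj_linear.
HB.instance Definition _ :=
  GRing.isMonoidMorphism.Build F B quot_proj quot_proj_monoid_morphism.

Lemma quot_proj_rel r : S r -> quot_proj r = 0.
Proof. by move=> Sr; apply/quot_piP; rewrite subr0; apply: ideal_gen_mem. Qed.

Variables (W : lmodType K) (a : alg_action F W).
Hypothesis S0 : forall r v, S r -> a r v = 0.

(** The action goes through a chosen representative; [quot_act_proj] shows that the choice is
    immaterial, because the ideal acts by zero. *)
Definition quot_act (x : B) (v : W) : W := a (repr (x : Defs.quot_type S)) v.

Lemma quot_act_proj x v : quot_act (quot_proj x) v = a x v.
Proof.
apply/eqP; rewrite -subr_eq0 -alg_actNl -alg_actDl.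
by apply/eqP/(ideal_act0 S0)/quot_piP; rewrite quot_reprK.
Qed.

Lemma quot_act_linearl v : linear (quot_act^~ v).
Proof.
move=> c; elim/quot_piW => x; elim/quot_piW => y.
by rewrite -!/(quot_proj _) -quot_proj_linear !quot_act_proj (alg_act_linearl a).
Qed.

Lemma quot_act_linearr x : linear (quot_act x).
Proof. by move=> c u v; apply: alg_act_linearr. Qed.

Lemma quot_act1 v : quot_act 1 v = v.
Proof. by rewrite -[1]/(quot_proj 1) quot_act_proj alg_act1. Qed.

Lemma quot_actM x y v : quot_act (x * y) v = quot_act x (quot_act y v).
Proof.
elim/quot_piW: x => x; elim/quot_piW: y => y.
rewrite -!/(quot_proj _) -quot_proj_monoid_morphism.2 !quot_act_proj.
exact: alg_actM.
Qed.

Definition quot_action : action B W :=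
  Action quot_act_linearl quot_act_linearr quot_act1 quot_actM.

End QuotientAction.

Record alg_mor (K : comNzRingType) (B A : pzAlg K) := AlgMor {
  mor :> B -> A;
  mor_linear : linear mor;
  mor1 : mor 1 = 1;
  morM : forall x y, mor (x * y) = mor x * mor y
}.

Section MorTheory.
Variables (K : comNzRingType) (B A : pzAlg K) (f : alg_mor B A).

Lemma morD x y : f (x + y) = f x + f y.
Proof. exact: (raddfD (linear_of (mor_linear f))). Qed.
Lemma morN x : f (- x) = - f x.
Proof. exact: (raddfN (linear_of (mor_linear f))). Qed.
Lemma morZ c x : f (c *: x) = c *: f x.
Proof. exact: (linearZ_LR (linear_of (mor_linear f))). Qed.
Lemma mor0 : f 0 = 0.
Proof. exact: (linear0_of (mor_linear f)). Qed.
Lemma mor_prod (I : Type) (r : seq I) (g : I -> B) :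
  f (\prod_(i <- r) g i) = \prod_(i <- r) f (g i).
Proof. exact: (big_morph _ (morM f) (mor1 f)). Qed.

End MorTheory.

Section GeneratedAlgebra.
Variables (K : comNzRingType) (B : pzAlg K) (X : Type) (gn : X -> B).

(** Generation is encoded as the induction principle for linear combinations of words, each word
    being built from 1 by left multiplications. *)
Definition generated_by := forall P : B -> Prop,
    P 1 -> (forall c x y, P x -> P y -> P (c *: x + y)) ->
    (forall g x, P x -> P (gn g * x)) ->
  forall x, P x.

Hypothesis genW : generated_by.

(* Evaluating the action by left multiplication at the unit. *)
Lemma alg_mor_of_action (A : pzAlg K) (h : X -> A) (a : action B A) :
    (forall g v, a (gn g) v = h g * v) ->
  exists f : alg_mor B A, forall g, f (gn g) = h g.
Proof.
move=> ah; have aE x v : a x v = a x 1 * v.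
  elim/genW: x v => [|c x y IHx IHy|g x IH] v.
  - by rewrite !act1 mul1r.
  - by rewrite !(actDl, actZl) mulrDl pz_mulAl -IHx -IHy.
  - by rewrite !actM !ah IH mulrA.
have aM x y : a (x * y) 1 = a x 1 * a y 1 by rewrite actM aE.
by exists (AlgMor (act_linearl a 1) (act1 a 1) aM) => g /=; rewrite ah mulr1.
Qed.

End GeneratedAlgebra.

(** * Presented algebras *)

Section Presented.
Variables (K : comNzRingType) (X : choiceType) (S : free_alg K X -> Prop).
Local Notation F := (free_alg K X).
Local Notation B := (presented_alg S).

Lemma presented_generated : generated_by (pgen S).
Proof.
move=> P P1 PD PM; elim/quot_piW => x; rewrite -/(quot_proj S x).
elim/free_algW: x => [//|c x y Px Py|g x Px].
  by rewrite quot_proj_linear; apply: PD.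
by rewrite (quot_proj_monoid_morphism S).2; apply: PM.
Qed.

Variables (W : lmodType K) (op : X -> W -> W).
Hypothesis op_linear : forall g, linear (op g).

Definition free_action : alg_action F W :=
  gen_action (@free_algW K X) op_linear (free_act_linearl op) (free_act1 op)
    (free_act_genM op_linear).

Lemma free_actionE g v : free_action (gen K g) v = op g v.
Proof. exact: gen_actionE. Qed.

Hypothesis op_rel : forall r v, S r -> free_action r v = 0.

Definition presented_action : action B W := quot_action op_rel.

Lemma presented_actionE g v : presented_action (pgen S g) v = op g v.
Proof. by rewrite -free_actionE; apply: quot_act_proj. Qed.

End Presented.

(** * The Clifford algebra *)

Lemma mulr_prod_anticomm (A : pzRingType) (I : Type) (s : seq I) (x : A)
    (w : I -> A) (e : I -> nat) :
    (forall j, x * w j = (-1) ^+ e j * (w j * x)) ->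
  x * \prod_(j <- s) w j = (-1) ^+ (\sum_(j <- s) e j) * (\prod_(j <- s) w j * x).
Proof.
move=> xw; elim: s => [|j s IH]; first by rewrite !big_nil mulr1 !mul1r.
rewrite !big_cons mulrA xw -!mulrA IH exprD -!mulrA; congr (_ * _).
by rewrite !mulrA; congr (_ * _ * _); rewrite -signr_odd commr_sign.
Qed.

Definition clifford_family (A : pzRingType) m (w : 'I_m -> A) :=
  forall j k, w j * w k + w k * w j = 2%:R *+ (j == k).

Section CliffordFamily.
Variables (A : pzRingType) (m : nat) (w : 'I_m -> A).
Hypotheses (wC : clifford_family w) (om : odd m).

(** The generator [w k] commutes with itself and anticommutes with the m - 1 others, an even
    number. *)
Lemma clifford_volume_gen k : w k * \prod_(j < m) w j = (\prod_(j < m) w j) * w k.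
Proof.
rewrite (@mulr_prod_anticomm _ _ _ _ _ (fun j => (j != k) : nat)) => [|j].
  rewrite -signr_odd (_ : odd _ = false) ?mul1r //.
  move: (w) (om) k => _; case: m => // m' om' k.
  rewrite (bigD1 k) //= eqxx add0n (eq_bigr (fun=> 1%N)) => [|j -> //].
  by rewrite sum1_card cardC1 card_ord; apply: negbTE.
have [->|jk] := eqVneq j k; first by rewrite mul1r.
by rewrite mulN1r; apply/eqP; rewrite -addr_eq0 wC [k == j]eq_sym (negPf jk).
Qed.

Lemma clifford_volumeN : \prod_(j < m) - w j = - \prod_(j < m) w j.
Proof. by rewrite prodrN card_ord -signr_odd om mulN1r. Qed.

Lemma clifford_familyN : clifford_family (fun j => - w j).
Proof. by move=> j k; rewrite !mulrNN. Qed.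

End CliffordFamily.

(* A presentation is recorded as generation together with the universal property
   that operators satisfying the relations define a module. *)
Record is_clifford (K : comNzRingType) (m : nat) (Cl : pzAlg K)
    (w : 'I_m -> Cl) : Prop := IsClifford {
  clifford_generated : generated_by w;
  clifford_relation : clifford_family w;
  clifford_action : forall (W : lmodType K) (o : 'I_m -> W -> W),
    (forall j, linear (o j)) ->
    (forall j k v, o j (o k v) + o k (o j v) = v *+ 2 *+ (j == k)) ->
    exists a : action Cl W, forall j v, a (w j) v = o j v
}.

Section Clifford.
Variables (K : comNzRingType) (m : nat) (Cl : pzAlg K) (w : 'I_m -> Cl).
Hypotheses (Clw : is_clifford w) (om : odd m).

(** Left multiplication by the [h j] turns [A] into a module over [Cl]; the morphism is the orbit
    map of 1. *)
Lemma clifford_hom (A : pzAlg K) (h : 'I_m -> A) : clifford_family h ->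
  exists f : alg_mor Cl A, forall j, f (w j) = h j.
Proof.
move=> hC; have [j|j k v|a ah] := clifford_action Clw (o := fun j v => h j * v).
- by move=> c u v; rewrite mulrDr pz_mulAr.
- by rewrite !mulrA -mulrDl hC mulrnAl mulr_natl.
- exact: (alg_mor_of_action (clifford_generated Clw) ah).
Qed.

Lemma clifford_volumeC c : c * \prod_(j < m) w j = \prod_(j < m) w j * c.
Proof.
elim/(clifford_generated Clw): c => [|a x y IHx IHy|k x IH].
- by rewrite mul1r mulr1.
- by rewrite mulrDl mulrDr pz_mulAl pz_mulAr IHx IHy.
- by rewrite -mulrA IH !mulrA -(clifford_volume_gen (clifford_relation Clw)).
Qed.

(** The relations are even in the generators, hence stable under negating all of them; this gives
    the parity involution. *)
Lemma clifford_sign : exists s : alg_mor Cl Cl,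
  (forall j, s (w j) = - w j) /\ forall c, s (s c) = c.
Proof.
have [s sw] := clifford_hom (clifford_familyN (clifford_relation Clw)).
exists s; split=> //; elim/(clifford_generated Clw) => [|a x y IHx IHy|k x IH].
- by rewrite !mor1.
- by rewrite !mor_linear IHx IHy.
- by rewrite !morM IH sw morN sw opprK.
Qed.

End Clifford.

(** * A trace on the Clifford algebra that detects the volume element *)

Definition mx_pzAlg (K : comNzRingType) (N : nat) : pzAlg K :=
  @PzAlg K 'M[K]_N *:%R (@scalerA _ _) (@scale1r _ _) (@scalerDr _ _)
    (fun u a b => scalerDl u a b) (@scalemxAl _ _ _ _)
    (@scalemxAr _ _ _ _).

(* Spin representation: the size doubles and two generators are added at each
   step; the volume element stays scalar because the number of generators is
   odd. *)
Lemma gamma_matrices (C : numClosedFieldType) n :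
  exists (N : nat) (g : nat -> 'M[C]_N) (c : C),
    [/\ (0 < N)%N, c != 0,
        forall j k, (j < (2 * n).+1)%N -> (k < (2 * n).+1)%N ->
          g j * g k + g k * g j = 2%:R *+ (j == k)
      & \prod_(j < (2 * n).+1) g j = c%:M].
Proof.
elim: n => [|n [N [g [c [N0 c0 gg gp]]]]].
  exists 1, (fun=> 1), 1; split; rewrite ?oner_neq0 //.
    by move=> [] // [] // _ _; rewrite mulr1.
  by rewrite big_ord1.
(* Pauli matrices: the old generators become sigma_1 tensor g_j, the new ones are sigma_2 and
   sigma_3. As sigma_1 sigma_2 sigma_3 = i, the volume scalar is multiplied by ['i]. *)
pose g' j : 'M[C]_(N + N) := if (j < (2 * n).+1)%N then block_mx 0 (g j) (g j) 0
  else if j == (2 * n).+1 then block_mx 0 (- 'i)%:M 'i%:M 0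
  else block_mx 1%:M 0 0 (- 1%:M).
have E00 (X Y Z T : 'M[C]_N) :
    (block_mx 0 X Y 0 : 'M_(N + N)) * block_mx 0 Z T 0 = block_mx (X * T) 0 0 (Y * Z).
  by rewrite [LHS]mulmx_block !mulmx0 !mul0mx ?add0r ?addr0.
have E10 (X Y Z T : 'M[C]_N) :
    (block_mx X 0 0 Y : 'M_(N + N)) * block_mx 0 Z T 0 = block_mx 0 (X * Z) (Y * T) 0.
  by rewrite [LHS]mulmx_block !mulmx0 !mul0mx ?add0r ?addr0.
have E01 (X Y Z T : 'M[C]_N) :
    (block_mx 0 X Y 0 : 'M_(N + N)) * block_mx Z 0 0 T = block_mx 0 (X * T) (Y * Z) 0.
  by rewrite [LHS]mulmx_block !mulmx0 !mul0mx ?add0r ?addr0.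
have E11 (X Y Z T : 'M[C]_N) :
    (block_mx X 0 0 Y : 'M_(N + N)) * block_mx Z 0 0 T = block_mx (X * Z) 0 0 (Y * T).
  by rewrite [LHS]mulmx_block !mulmx0 !mul0mx ?add0r ?addr0.
have D (X Y Z T X' Y' Z' T' : 'M[C]_N) :
    (block_mx X Y Z T : 'M_(N + N)) + block_mx X' Y' Z' T'
    = block_mx (X + X') (Y + Y') (Z + Z') (T + T') by exact: add_block_mx.
have I1 : (1 : 'M[C]_(N + N)) = block_mx 1 0 0 1 by exact: scalar_mx_block.
have g'1 j : (j < (2 * n).+1)%N -> g' j = block_mx 0 (g j) (g j) 0 by rewrite /g' => ->.
have g'2 : g' (2 * n).+1 = block_mx 0 (- 'i)%:M 'i%:M 0 by rewrite /g' ltnn eqxx.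
have g'3 : g' (2 * n).+2 = block_mx 1 0 0 (- 1).
  by rewrite /g' ltnNge leqnSn /= gtn_eqF.
have iM (X : 'M[C]_N) : X * 'i%:M = 'i *: X by exact: mul_mx_scalar.
have iMl (X : 'M[C]_N) : 'i%:M * X = 'i *: X by exact: mul_scalar_mx.
have NiM : (- 'i)%:M = - 'i%:M :> 'M[C]_N by exact: raddfN.
have ii : 'i%:M * 'i%:M = - 1 :> 'M[C]_N.
  by rewrite iM scale_scalar_mx -expr2 sqrCi [LHS]raddfN.
have lt3 j : (j < (2 * n.+1).+1)%N ->
    [\/ (j < (2 * n).+1)%N, j = (2 * n).+1 | j = (2 * n).+2].
  rewrite mulnS add2n ltnS leq_eqVlt => /orP[/eqP|]; first by constructor 3.
  by rewrite ltnS leq_eqVlt => /orP[/eqP|]; [constructor 2|constructor 1].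
exists (N + N)%N, g', ('i * c)%R; split.
- by rewrite addn_gt0 N0.
- by rewrite mulf_neq0 ?neq0Ci.
- move=> j k /lt3[jM|->|->] /lt3[kM|->|->]; rewrite ?(g'1 j) ?(g'1 k) // ?g'2 ?g'3.
  + rewrite !E00 D !addr0 gg //; case: eqP => _; last by rewrite !mulr0n block_mx0.
    by rewrite !mulr1n !mulr2n I1 D !addr0.
  + rewrite !E00 D !addr0 NiM iM mulrN iM mulNr !iMl addrN addNr (ltn_eqF jM).
    by rewrite block_mx0.
  + rewrite E01 E10 D !addr0 !mulr1 !mul1r !mulrN !mulNr !mulr1 !mul1r addrN addNr.
    by rewrite (ltn_eqF (leqW jM)) block_mx0.
  + rewrite !E00 D !addr0 NiM iM mulrN iM mulNr !iMl addrN addNr (gtn_eqF kM).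
    by rewrite block_mx0.
  + by rewrite !E00 D NiM mulrN mulNr ii !opprK eqxx I1 mulr1n [RHS]mulr2n D.
  + rewrite E01 E10 D !addr0 !mulr1 !mul1r !mulrN !mulNr !mulr1 !mul1r addrN addNr.
    by rewrite ltn_eqF // block_mx0.
  + rewrite E01 E10 D !addr0 !mulr1 !mul1r !mulrN !mulNr !mulr1 !mul1r addrN addNr.
    by rewrite (gtn_eqF (leqW kM)) block_mx0.
  + rewrite E01 E10 D !addr0 !mulr1 !mul1r !mulrN !mulNr !mulr1 !mul1r addrN addNr.
    by rewrite gtn_eqF // block_mx0.
  + by rewrite !E11 D mulrNN !mulr1 !addr0 eqxx I1 mulr1n [RHS]mulr2n D !addr0.
- have gprod k : (k <= (2 * n).+1)%N -> \prod_(j < k) g' j =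
      if odd k then block_mx 0 (\prod_(j < k) g j) (\prod_(j < k) g j) 0
      else block_mx (\prod_(j < k) g j) 0 0 (\prod_(j < k) g j).
    elim: k => [|k IH] kM; first by rewrite !big_ord0 I1.
    rewrite !big_ord_recr /= IH 1?ltnW // g'1 //.
    by case: (odd k); rewrite ?E00 ?E10.
  have oM : odd (2 * n).+1 by rewrite /= mul2n odd_double.
  rewrite mulnS add2n 2!big_ord_recr /= gprod // oM.
  rewrite gp g'2 g'3 E00 E11 !mulr1 NiM !mulrN ?mulNr ?mulr1 opprK iM scale_scalar_mx.
  by rewrite -scalar_mx_block.
Qed.

(** The trace of the spin representation, antisymmetrized under [s]. The volume element is odd and
    acts as the scalar c on a space of dimension N, so its value is 2 N c. *)
Lemma clifford_trace (C : numClosedFieldType) n (Cl : pzAlg C)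
    (w : 'I_(2 * n + 1) -> Cl) (s : alg_mor Cl Cl) : is_clifford w ->
    (forall j, s (w j) = - w j) -> (forall x, s (s x) = x) ->
  exists t : Cl -> C, [/\ linear (t : Cl -> C^o), forall x y, t (x * y) = t (y * x),
    forall x, t (s x) = - t x & t (\prod_j w j) != 0].
Proof.
move=> Clw sw ss; have [N [g [c [N0 c0 gg gp]]]] := gamma_matrices C n.
have gC : clifford_family (fun j : 'I_(2 * n + 1) => g j : mx_pzAlg C N).
  by move=> j k; apply: (gg j k); rewrite -(addn1 (2 * n)) ltn_ord.
have [r rw] := clifford_hom Clw gC.
pose t x : C := \tr (r x : 'M_N) - \tr (r (s x) : 'M_N).
have om : odd (2 * n + 1) by rewrite addn1 /= mul2n odd_double.
exists t; split=> [a x y|x y|x|].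
- rewrite /t !mor_linear [X in _ = _ *: X + _]/=.
  by rewrite !mxtraceD !mxtraceZ scalerBr addrACA opprD.
- by rewrite /t !morM mxtrace_mulC [X in _ - X]mxtrace_mulC.
- by rewrite /t ss opprB.
have rp : r (\prod_j w j) = c%:M.
  by rewrite mor_prod (eq_bigr _ (fun j _ => rw j)) -gp addn1.
have sp : s (\prod_j w j) = - \prod_j w j.
  by rewrite mor_prod (eq_bigr _ (fun j _ => sw j)) clifford_volumeN.
rewrite /t sp morN rp [\tr (- _)]raddfN /= !mxtrace_scalar opprK -mulr2n -mulrnA.
by rewrite -mulr_natr mulf_neq0 // pnatr_eq0 -lt0n muln_gt0 N0.
Qed.

Lemma presented_clifford (K : comNzRingType) (m : nat) :
  exists (Cl : pzAlg K) (w : 'I_m -> Cl), is_clifford w.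
Proof.
pose S (F : algType K) (w : 'I_m -> F) x :=
  exists j k, x = w j * w k + w k * w j - 2%:R *+ (j == k).
pose S0 := S _ (fun j : 'I_m => gen K j).
exists (presented_alg S0), (pgen S0); split; first exact: presented_generated.
- have proj (F : algType K) (g : 'I_m -> F) :
     clifford_family (fun j => quot_proj (S F g) (g j)).
   move=> j k; apply/eqP; rewrite -subr_eq0 -(rmorph_nat (quot_proj (S F g))).
   rewrite -!rmorphM -rmorphD -rmorphMn -rmorphB; apply/eqP/quot_proj_rel.
   by exists j, k.
  exact: proj.
- move=> W o oL oo.
  have rel (F : algType K) (g : 'I_m -> F) (a : alg_action F W) :
      (forall j v, a (g j) v = o j v) -> forall r v, S F g r -> a r v = 0.
    by move=> ao r v [j [k ->]]; rewrite !alg_actE !ao oo subrr.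
  have rel0 := rel _ _ _ (free_actionE oL).
  by exists (presented_action rel0); apply: presented_actionE.
Qed.

(** * Poincare-Birkhoff-Witt basis of A_0 over the Clifford algebra *)

(* The commutator of f and e is the sum of a part that commutes with e and a
   part that anticommutes with it; the latter telescopes. *)
Lemma commutator_exp (A : pzRingType) (e f u v : A) :
    f * e = e * f + (u + v) -> e * u = u * e -> e * v = - (v * e) ->
  forall a, f * e ^+ a = e ^+ a * f + (u *+ a + v *+ odd a) * e ^+ a.-1.
Proof.
move=> fe eu ev; elim=> [|a IH]; first by rewrite !mulr0n addr0 mul0r addr0 mulr1 mul1r.
have eau : e ^+ a * u = u * e ^+ a by exact/esym/commrX/esym.
have eav : e ^+ a * v = (-1) ^+ a * v * e ^+ a.
  elim: a {IH eau} => [|a IH]; first by rewrite !mul1r mulr1.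
  by rewrite exprSr -mulrA ev mulrN mulrA IH -(mulrA _ _ e) (exprS (-1)) mulN1r !mulNr.
have -> : e ^+ a.+1.-1 = e ^+ a by [].
rewrite exprSr mulrA IH mulrDl -mulrA fe mulrDr mulrDr mulrA -exprSr -addrA.
congr (_ + _); rewrite eau eav.
have -> : (u *+ a + v *+ odd a) * e ^+ a.-1 * e = (u *+ a + v *+ odd a) * e ^+ a.
  by case: a {IH eau eav} => [|a]; rewrite ?addr0 ?mul0r // -mulrA -exprSr.
rewrite -!mulrDl; congr (_ * _).
(* The coefficient of [v] is the alternating sum 1 - 1 + 1 - ... with a terms, that is [odd a];
   passing to a + 1 adds (-1)^a. *)
rewrite addrACA -mulrS; congr (_ + _); rewrite -signr_odd /=.
by case: (odd a); rewrite ?expr1 ?expr0 ?mulN1r ?addNr ?mul1r ?addr0.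
Qed.

(** The type [T] is left free because the same packaging serves for elements of an algebra and for
    operators on a module. *)
Definition A_gen (T : Type) m (w : 'I_m -> T) (Ep Em : T) (x : 'I_m + bool) : T :=
  match x with inl j => w j | inr true => Ep | inr false => Em end.

(** The presentation of A_0 up to isomorphism. The commutator is oriented as a rewriting rule that
    moves E_+ to the left of E_-, towards the monomials E_+^a E_-^b. *)
Record is_A0 (C : fieldType) (m : nat) (A : pzAlg C) (w : 'I_m -> A)
    (Ep Em : A) : Prop := IsA0 {
  A0_generated : generated_by (A_gen w Ep Em);
  A0_clifford : clifford_family w;
  A0_commutator : Em * Ep = Ep * Em + 4%:R^-1 *: (1 : A);
  A0_plus : forall j, Ep * w j = - (w j * Ep);
  A0_minus : forall j, Em * w j = - (w j * Em);
  A0_action : forall (W : lmodType C) (ow : 'I_m -> W -> W) (op om : W -> W),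
    (forall j, linear (ow j)) -> linear op -> linear om ->
    (forall j k v, ow j (ow k v) + ow k (ow j v) = v *+ 2 *+ (j == k)) ->
    (forall v, om (op v) = op (om v) + 4%:R^-1 *: v) ->
    (forall j v, op (ow j v) = - ow j (op v)) ->
    (forall j v, om (ow j v) = - ow j (om v)) ->
    exists a : action A W, [/\ forall j v, a (w j) v = ow j v,
      forall v, a Ep v = op v & forall v, a Em v = om v]
}.

Section PBW.
Variables (C : fieldType) (m : nat).
Variables (Cl : pzAlg C) (wc : 'I_m -> Cl) (s : alg_mor Cl Cl).
Hypotheses (Clw : is_clifford wc) (sw : forall j, s (wc j) = - wc j)
  (sK : forall c, s (s c) = c).

Section Monomials.
Variables (A : pzAlg C) (w : 'I_m -> A) (Ep Em : A) (i : alg_mor Cl A).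
Hypothesis iw : forall j, i (wc j) = w j.
Hypotheses (Epw : forall j, Ep * w j = - (w j * Ep))
  (Emw : forall j, Em * w j = - (w j * Em)).

Definition pbw_mon (c : Cl) (a b : nat) : A := i c * Ep ^+ a * Em ^+ b.

Lemma anticomm_sign (e : A) : (forall j, e * w j = - (w j * e)) ->
  forall c, e * i c = i (s c) * e.
Proof.
move=> ew; elim/(clifford_generated Clw) => [|a x y IHx IHy|j x IH].
- by rewrite !mor1 mulr1 mul1r.
- by rewrite !mor_linear mulrDr mulrDl pz_mulAl pz_mulAr IHx IHy.
- by rewrite !morM iw sw morN iw mulrA ew !mulNr -!mulrA IH.
Qed.

Lemma pbw_mon_linear a b : linear (fun c => pbw_mon c a b).
Proof. by move=> x c d; rewrite /pbw_mon mor_linear !mulrDl !pz_mulAl. Qed.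

Lemma pbw_monN c a b : pbw_mon (- c) a b = - pbw_mon c a b.
Proof. exact: (raddfN (linear_of (pbw_mon_linear a b))). Qed.

Lemma pbw_monZ k c a b : pbw_mon (k *: c) a b = k *: pbw_mon c a b.
Proof. exact: (linearZ_LR (linear_of (pbw_mon_linear a b))). Qed.

Lemma pbw_mon_gen j c a b : w j * pbw_mon c a b = pbw_mon (wc j * c) a b.
Proof. by rewrite /pbw_mon morM iw !mulrA. Qed.

Lemma pbw_mon_plus c a b : Ep * pbw_mon c a b = pbw_mon (s c) a.+1 b.
Proof. by rewrite /pbw_mon !mulrA (anticomm_sign Epw) exprS mulrA. Qed.

(** Two commutators are covered at once: v = 0 gives A_0, and v = - Lambda times the volume term
    gives A_Lambda. *)
Lemma pbw_mon_minus (u v : A) : Em * Ep = Ep * Em + (u + v) ->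
    Ep * u = u * Ep -> Ep * v = - (v * Ep) ->
  forall c a b, Em * pbw_mon c a b = pbw_mon (s c) a b.+1 +
    i (s c) * ((u *+ a + v *+ odd a) * Ep ^+ a.-1 * Em ^+ b).
Proof.
move=> EE eu ev c a b.
rewrite /pbw_mon !mulrA (anticomm_sign Emw) -(mulrA (i (s c)) Em (Ep ^+ a)).
by rewrite (commutator_exp EE eu ev) mulrDr mulrDl exprS !mulrA.
Qed.

End Monomials.

Variables (A : pzAlg C) (w : 'I_m -> A) (Ep Em : A) (i : alg_mor Cl A).
Hypotheses (HA : is_A0 w Ep Em) (iw : forall j, i (wc j) = w j).
Local Notation mon := (pbw_mon Ep Em i).

Lemma A0_mon_minus c a b :
  Em * mon c a b = mon (s c) a b.+1 + (a%:R / 4%:R) *: mon (s c) a.-1 b.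
Proof.
have EE : Em * Ep = Ep * Em + (4%:R^-1 *: (1 : A) + 0).
  by rewrite addr0 (A0_commutator HA).
have eu : Ep * (4%:R^-1 *: (1 : A)) = 4%:R^-1 *: (1 : A) * Ep.
  by rewrite pz_mulAl pz_mulAr mul1r mulr1.
have ev : Ep * 0 = - (0 * Ep) by rewrite mulr0 mul0r oppr0.
rewrite (pbw_mon_minus iw (A0_minus HA) EE eu ev); congr (_ + _).
rewrite mul0rn addr0 -scaler_nat scalerA pz_mulAl mul1r pz_mulAl pz_mulAr.
by rewrite mulrA.
Qed.

(** Sums suffice: scalars and zero are absorbed by the Clifford coefficient of a monomial. *)
Inductive pbw_span : A -> Prop :=
| pbw_span_mon c a b : pbw_span (mon c a b)
| pbw_span_add x y of pbw_span x & pbw_span y : pbw_span (x + y).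

Lemma pbw_spanT x : pbw_span x.
Proof.
elim/(A0_generated HA): x => [|k x y sx sy|[j|[]] x sx].
- by rewrite -[1]mulr1 -[1 * 1]mulr1 -{1}(mor1 i); apply: (pbw_span_mon 1 0 0).
- apply: pbw_span_add => //; elim: sx => [c a b|u v _ su _ sv].
    by rewrite -pbw_monZ; constructor.
  by rewrite scalerDr; constructor.
- elim: sx => [c a b|u v _ su _ sv] /=; last by rewrite mulrDr; constructor.
  by rewrite (pbw_mon_gen Ep Em iw); constructor.
- elim: sx => [c a b|u v _ su _ sv] /=; last by rewrite mulrDr; constructor.
  by rewrite (pbw_mon_plus Em iw (A0_plus HA)); constructor.
- elim: sx => [c a b|u v _ su _ sv] /=; last by rewrite mulrDr; constructor.
  rewrite A0_mon_minus -pbw_monZ.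
  by constructor; constructor.
Qed.

Lemma pbwW (P : A -> Prop) : (forall c a b, P (mon c a b)) ->
  (forall x y, P x -> P y -> P (x + y)) -> forall x, P x.
Proof. by move=> Pm PD x; elim: (pbw_spanT x) => // u v _ Pu _; apply: PD. Qed.

Let V : lmodType C := (nat -> nat -> Cl)%type.

Let vgen (j : 'I_m) (v : V) : V := fun a b => wc j * v a b.
Let vplus (v : V) : V := fun a b => if a is a'.+1 then s (v a' b) else 0.
(** The coordinate at (a, b) receives contributions from (a, b - 1) and, by the Weyl relation, from
    (a + 1, b); this shift turns the factor a/4 of [A0_mon_minus] into (a + 1)/4. *)
Let vminus (v : V) : V := fun a b =>
  (if b is b'.+1 then s (v a b') else 0) + (a.+1%:R / 4%:R) *: s (v a.+1 b).
Let vdelta c (a b : nat) : V := fun a' b' => if (a' == a) && (b' == b) then c else 0.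

(** Acting on the delta function at (0, 0) with value 1 reads off the coordinates of an element; the
    monomials are therefore independent over [Cl]. *)
Lemma pbw_eval : exists ev : A -> V,
  linear ev /\ forall c a b, ev (mon c a b) = vdelta c a b.
Proof.
have VD (u v : V) a b : (u + v) a b = u a b + v a b by [].
have VN (u : V) a b : (- u) a b = - u a b by [].
have VZ c (u : V) a b : (c *: u) a b = c *: u a b by [].
have VMn (u : V) k a b : (u *+ k) a b = u a b *+ k.
  by elim: k => // k IH; rewrite !mulrS VD IH.
have V2 (u v : V) : (forall a b, u a b = v a b) -> u = v.
  by move=> uv; apply/funext => a; apply/funext => b.
have oL j : linear (vgen j).
  by move=> c u v; apply: V2 => a b; rewrite /vgen VD VZ mulrDr pz_mulAr.
have pL : linear vplus.
  move=> c u v; apply: V2 => -[|a] b; rewrite VD VZ /vplus ?scaler0 ?addr0 //.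
  by rewrite VD VZ mor_linear.
have mL : linear vminus.
  move=> c u v; apply: V2 => a b; rewrite VD VZ /vminus !VD !VZ mor_linear.
  case: b => [|b]; rewrite ?VD ?VZ ?mor_linear ?add0r !scalerDr !scalerA.
    by rewrite (mulrC c).
  by rewrite (mulrC c) addrACA.
have oC j k v : vgen j (vgen k v) + vgen k (vgen j v) = v *+ 2 *+ (j == k).
  apply: V2 => a b; rewrite VD !VMn /vgen !mulrA -mulrDl (clifford_relation Clw).
  by rewrite mulrnAl mulr_natl.
have mp v : vminus (vplus v) = vplus (vminus v) + 4%:R^-1 *: v.
  apply: V2 => a b; rewrite VD VZ /vminus /vplus sK; case: a => [|a].
    by case: b => [|b]; rewrite ?mor0 !add0r mul1r.
  case: b => [|b]; rewrite morD morZ !sK ?mor0 -addrA; congr (_ + _);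
    by rewrite -scalerDl -[in LHS]natr1 mulrDl mul1r.
have pw j v : vplus (vgen j v) = - vgen j (vplus v).
  apply: V2 => -[|a] b; rewrite VN /vplus /vgen ?mulr0 ?oppr0 //.
  by rewrite morM sw mulNr.
have mw j v : vminus (vgen j v) = - vgen j (vminus v).
  apply: V2 => a b; rewrite VN /vminus /vgen mulrDr opprD morM sw mulNr.
  rewrite scalerN pz_mulAr; congr (_ - _).
  by case: b => [|b]; rewrite ?mulr0 ?oppr0 // morM sw mulNr.
have [act [aw ap am]] := A0_action HA oL pL mL oC mp pw mw.
have ai c v : act (i c) v = fun a b => c * v a b.
  elim/(clifford_generated Clw): c v => [|x c d IHc IHd|j c IH] v; apply: V2 => a b.
  - by rewrite mor1 act1 mul1r.
  - by rewrite mor_linear actDl actZl VD VZ IHc IHd mulrDl pz_mulAl.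
  - by rewrite morM actM IH iw aw /vgen mulrA.
have s0 : s 0 = 0 by exact: mor0.
have am0 b : act (Em ^+ b) (vdelta 1 0 0) = vdelta 1 0 b.
  elim: b => [|b IH]; first by rewrite act1.
  rewrite exprS actM IH am; apply: V2 => a' b'; rewrite /vminus /vdelta /= s0 scaler0.
  by case: b' => [|b']; rewrite ?andbF ?addr0 //; case: ifP => _; rewrite ?mor1 ?s0.
have ap0 a b : act (Ep ^+ a) (vdelta 1 0 b) = vdelta 1 a b.
  elim: a => [|a IH]; first by rewrite act1.
  rewrite exprS actM IH ap; apply: V2 => -[|a'] b' //.
  by rewrite /vplus /vdelta eqSS; case: ifP => _; rewrite ?mor1 ?s0.
exists (fun x => act x (vdelta 1 0 0)); split=> [|c a b]; first exact: act_linearl.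
rewrite /pbw_mon !actM am0 ap0 ai; apply/funext => a'; apply/funext => b'.
by rewrite /vdelta; case: ifP; rewrite ?mulr1 ?mulr0.
Qed.

(** The coordinates given by [pbw_eval] are plugged into [g] and summed. [V] allows infinite
    supports, so finiteness is recovered for each element from the fact that monomials span. *)
Lemma pbw_lift (Z : lmodType C) (g : nat -> nat -> Cl -> Z) :
    (forall a b, linear (g a b)) ->
  exists f : A -> Z, linear f /\ forall c a b, f (mon c a b) = g a b c.
Proof.
move=> gL; have [ev [evL evm]] := pbw_eval.
pose S M x := \sum_(a < M) \sum_(b < M) g a b (ev x a b).
have SL M : linear (S M).
  move=> k x y; rewrite /S scaler_sumr -big_split; apply: eq_bigr => a _ /=.
  rewrite scaler_sumr -big_split; apply: eq_bigr => b _ /=.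
  by rewrite evL -gL.
have Sm M c a b : (maxn a b < M)%N -> S M (mon c a b) = g a b c.
  rewrite gtn_max => /andP[aM bM].
  have g0 a' b' : g a' b' 0 = 0 by apply: linear0_of.
  rewrite /S evm (bigD1 (Ordinal aM)) //= [X in _ + X]big1 => [|a' a'a]; last first.
    apply: big1 => b' _; rewrite /vdelta ifF //.
    by apply/negbTE; apply: contraNN a'a => /andP[/eqP a'a _]; apply/eqP/val_inj.
  rewrite (bigD1 (Ordinal bM)) //= big1 => [|b' b'b]; last first.
    rewrite /vdelta ifF //.
    by apply/negbTE; apply: contraNN b'b => /andP[_ /eqP b'b]; apply/eqP/val_inj.
  by rewrite /vdelta !eqxx !addr0.
(* The truncated sums are eventually constant, from a rank that depends on [x] and is then picked by
   choice. *)
have SN x : exists N, forall M, (N <= M)%N -> S M x = S N x.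
  elim/pbwW: x => [c a b|x y [N SN] [N' SN']].
    by exists (maxn a b).+1 => M MN; rewrite !Sm.
  exists (maxn N N') => M; rewrite geq_max => /andP[NM NM'].
  have SD M' : S M' (x + y) = S M' x + S M' y by exact: (raddfD (linear_of (SL M'))).
  rewrite !SD (SN M) // (SN' M) // -(SN (maxn N N')) ?leq_maxl //.
  by rewrite -(SN' (maxn N N')) ?leq_maxr.
have [N NP] := choice SN.
have SE x M : (N x <= M)%N -> S (N x) x = S M x by move=> /NP.
exists (fun x => S (N x) x); split=> [k x y|c a b].
  pose M := maxn (N (k *: x + y)) (maxn (N x) (N y)).
  rewrite !(SE _ M) ?SL // /M ?leq_maxl // leq_max ?leq_maxl ?leq_maxr orbT //.
set M := maxn (N (mon c a b)) (maxn a b).+1.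
by rewrite (SE _ M) ?leq_maxl // Sm // leq_max ltnSn orbT.
Qed.

End PBW.

(** * A trace on A_0 *)

Section Trace.
Variables (C : numFieldType) (m : nat).
Variables (Cl : pzAlg C) (wc : 'I_m -> Cl) (s : alg_mor Cl Cl).
Hypotheses (Clw : is_clifford wc) (sw : forall j, s (wc j) = - wc j)
  (sK : forall c, s (s c) = c).
Variables (A : pzAlg C) (w : 'I_m -> A) (Ep Em : A) (i : alg_mor Cl A).
Hypotheses (HA : is_A0 w Ep Em) (iw : forall j, i (wc j) = w j).
Local Notation mon := (pbw_mon Ep Em i).

Lemma exp_sign (e : A) b c : (forall j, e * w j = - (w j * e)) ->
  e ^+ b * i c = i (iter b s c) * e ^+ b.
Proof.
move=> ew; elim: b => [|b IH]; first by rewrite mul1r mulr1.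
by rewrite exprS -mulrA IH mulrA (anticomm_sign Clw sw iw ew) -mulrA.
Qed.

Lemma pbw_mon_genr c a b j :
  mon c a b * w j = mon (c * iter (a + b) s (wc j)) a b.
Proof.
rewrite /pbw_mon -!mulrA -iw (exp_sign b _ (A0_minus HA)) (mulrA (Ep ^+ a)).
by rewrite (exp_sign a _ (A0_plus HA)) -iterD morM !mulrA.
Qed.

Lemma pbw_mon_minusr c a b : mon c a b * Em = mon c a b.+1.
Proof. by rewrite /pbw_mon exprSr mulrA. Qed.

Lemma pbw_mon_plusr c a b :
  mon c a b * Ep = mon c a.+1 b + (b%:R / 4%:R) *: mon c a b.-1.
Proof.
have EE : Ep * Em = Em * Ep + (- (4%:R^-1 *: (1 : A)) + 0).
  by rewrite addr0 (A0_commutator HA) addrK.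
have eu : Em * - (4%:R^-1 *: (1 : A)) = - (4%:R^-1 *: (1 : A)) * Em.
  by rewrite mulrN mulNr pz_mulAl pz_mulAr mul1r mulr1.
have ev : Em * 0 = - (0 * Em) by rewrite mulr0 mul0r oppr0.
have EmEp := commutator_exp EE eu ev b.
have -> : mon c a b * Ep = i c * Ep ^+ a * (Ep * Em ^+ b + (b%:R / 4%:R) *: Em ^+ b.-1).
  rewrite /pbw_mon -[LHS]mulrA; congr (_ * _); rewrite EmEp -addrA mul0rn addr0 mulNrn mulNr.
  by rewrite -scaler_nat scalerA pz_mulAl mul1r addNr addr0.
by rewrite mulrDr pz_mulAr mulrA /pbw_mon exprSr (mulrA (i c)).
Qed.

Variable t : Cl -> C.
Hypotheses (tL : linear (t : Cl -> C^o)) (tC : forall x y, t (x * y) = t (y * x))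
  (ts : forall x, t (s x) = - t x).

(* On monomials with a = b the supertrace of E_+^a E_-^a over the Weyl algebra
   obeys k_(a+1) = - (a + 1) k_a / 8. *)
Let kappa (a : nat) : C := a`!%:R * (- (4%:R^-1 / 2%:R)) ^+ a.

Let kappaS a : kappa a.+1 + kappa a.+1 = - (a.+1%:R / 4%:R * kappa a).
Proof.
rewrite /kappa factS natrM exprS mulrACA -mulrDl -mulrDr -opprD -splitr.
by rewrite mulrN mulNr.
Qed.

(** Cyclicity need only be tested with one factor a generator and the other a monomial. For E_+ and
    E_-, the sign in [ts] turns it into the recursion [kappaS]. The value at 1 is t 1 = 0, as it
    must be for a commutator. *)
Lemma A0_trace : exists T : A -> C, [/\ linear (T : A -> C^o),
  forall x y, T (x * y) = T (y * x) & forall c, T (i c) = t c].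
Proof.
have t0 : t 0 = 0 by apply: (linear0_of tL).
pose g a b c : C^o := if a == b then kappa a * t c else 0.
have gL a b : linear (g a b).
  move=> k c d; rewrite /g; case: ifP => _; last by rewrite scaler0 addr0.
  by rewrite tL mulrDr [in LHS]mulrCA.
have [T [TL Tm]] := pbw_lift Clw sw sK HA iw gL.
have TD x y : T (x + y) = T x + T y by exact: (raddfD (linear_of TL)).
have TZ k x : T (k *: x) = k * T x by exact: (linearZ_LR (linear_of TL)).
have Tgen (x : 'I_m + bool) y : T (A_gen w Ep Em x * y) = T (y * A_gen w Ep Em x).
  elim/(pbwW Clw sw HA iw): y => [c a b|u v Pu Pv]; last first.
    by rewrite mulrDr mulrDl !TD Pu Pv.
  case: x => [j|[]] /=.
  - rewrite (pbw_mon_gen Ep Em iw) pbw_mon_genr !Tm /g; case: eqP => // ->.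
    rewrite tC; congr (_ * t (_ * _)).
    (* On the diagonal a = b, the generator is twisted by an even power of the involution [s], that
       is, not at all. *)
    by rewrite addnn; elim: b => [//|b IH]; rewrite doubleS !iterS sK -IH.
  - rewrite (pbw_mon_plus Clw sw Em iw (A0_plus HA)) pbw_mon_plusr TD TZ !Tm /g.
    case: b => [|b].
      by rewrite mul0r mul0r addr0.
    rewrite eqSS /=; case: eqP => [->|_]; last by rewrite mulr0 addr0.
    rewrite ts mulrA -mulrDl mulrN -mulNr; congr (_ * _).
    apply/eqP; rewrite eq_sym -subr_eq0 opprK addrAC kappaS.
    by rewrite addNr.
  - rewrite (A0_mon_minus Clw sw HA iw) pbw_mon_minusr TD TZ !Tm /g.
    case: a => [|a].
      by rewrite mul0r mul0r addr0.
    rewrite eqSS /=; case: eqP => [->|_]; last by rewrite mulr0 addr0.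
    rewrite ts !mulrN -opprD mulrA -mulrDl -mulNr; congr (_ * _).
    apply/eqP; rewrite eq_sym -subr_eq0 opprK addrA kappaS.
    by rewrite addNr.
exists T; split=> // [x y|c].
  elim/(A0_generated HA): x y => [|k x x' IHx IHx'|h x IH] y.
  - by rewrite mul1r mulr1.
  - by rewrite mulrDl mulrDr !TD pz_mulAl pz_mulAr !TZ IHx IHx'.
  - by rewrite -mulrA Tgen -mulrA IH mulrA.
have -> : i c = mon c 0 0 by rewrite /pbw_mon !mulr1.
by rewrite Tm /g eqxx /kappa fact0 !mul1r.
Qed.

End Trace.

(** * Operators on power series *)

Section PowerSeries.
Variables (K : comNzRingType) (A : pzAlg K).
Implicit Types f g : pseries A.

Definition ps_shift f : pseries A := fun k => if k is k'.+1 then f k' else 0.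

Lemma ps_shift_linear : linear ps_shift.
Proof.
move=> c f g; apply/funext => -[|k]; rewrite /ps_shift //.
by rewrite [RHS](_ : _ = c *: 0 + 0) // scaler0 addr0.
Qed.

Lemma ps_scaleE (c : pseries K) f :
  ps_scale c f = c 0%N *: f + ps_shift (ps_scale (c \o succn) f).
Proof.
apply/funext => k; rewrite /ps_scale big_ord_recl subn0.
rewrite [RHS](_ : _ = c 0%N *: f k + ps_shift (ps_scale (c \o succn) f) k) //.
congr (_ + _); case: k => [|k]; first by rewrite big_ord0.
by apply: eq_bigr => j _; rewrite /= subSS.
Qed.

Lemma ps_scale0 f : ps_scale (fun=> 0) f = 0.
Proof. by apply/funext => k; rewrite /ps_scale big1 // => j _; rewrite scale0r. Qed.

Lemma ps_scale_Lambda f : ps_scale (ps_Lambda K) f = ps_shift f.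
Proof.
rewrite ps_scaleE scale0r add0r; congr ps_shift; rewrite ps_scaleE scale1r.
rewrite (_ : (_ \o _) \o _ = fun=> 0); last exact/funext.
by rewrite ps_scale0 (linear0_of ps_shift_linear) addr0.
Qed.

Lemma ps_scale1 (c : pseries K) f : (forall k, c k.+1 = 0) -> ps_scale c f = c 0%N *: f.
Proof.
move=> c0; rewrite ps_scaleE (_ : _ \o _ = fun=> 0); last exact/funext.
by rewrite ps_scale0 (linear0_of ps_shift_linear) addr0.
Qed.

Lemma ps_linearW (T : pseries A -> pseries A) : ps_linear T ->
  linear T /\ forall f, T (ps_shift f) = ps_shift (T f).
Proof.
move=> TL; have TL' : linear T.
  move=> c f g; pose c' : pseries K := fun k => if k == 0%N then c else 0.
  have sc (h : pseries A) : ps_scale c' h = c *: h by rewrite ps_scale1.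
  by rewrite -!sc TL.
split=> // f; have := TL (ps_Lambda K) f 0.
by rewrite !addr0 (linear0_of TL') addr0 !ps_scale_Lambda.
Qed.

Variable T : pseries A -> pseries A.
Hypotheses (TL : linear T) (TS : forall f, T (ps_shift f) = ps_shift (T f)).

(** A scalar series c is c_0 + Lambda c', and the coefficient of degree k is reached after k such
    peelings; no convergence argument is needed. *)
Lemma ps_linear_shift : ps_linear T.
Proof.
move=> c f g; rewrite -[ps_scale c f]scale1r TL scale1r; congr (_ + _).
apply/funext => k; elim: k c => [|k IH] c.
  rewrite (ps_scaleE c f) (ps_scaleE c (T f)) TL TS.
  by [].
rewrite (ps_scaleE c f) (ps_scaleE c (T f)) TL TS.
rewrite [LHS](_ : _ = c 0%N *: T f k.+1 + T (ps_scale (c \o succn) f) k) // IH.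
by [].
Qed.

(** A series that vanishes up to degree k is a (k + 1)-fold shift, and [T] lets the shifts out. *)
Lemma ps_shift_local k f g : (forall l, (l <= k)%N -> f l = g l) -> T f k = T g k.
Proof.
have T0 h : (forall l, (l <= k)%N -> h l = 0) -> T h k = 0.
  elim: k h => [|k IH] h h0; have -> : h = ps_shift (h \o succn).
  - by apply/funext => -[|l] //=; rewrite h0.
  - by rewrite TS.
  - by apply/funext => -[|l] //=; rewrite h0.
  - by rewrite TS /= IH // => l lk; rewrite /= h0.
move=> fg; apply/eqP; rewrite -subr_eq0; apply/eqP.
have <- : T (f - g) k = T f k - T g k.
  by have -> : T (f - g) = T f - T g by exact: (raddfB (linear_of TL)).
apply: T0 => l lk; have -> : (f - g) l = f l - g l by [].
by rewrite fg // subrr.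
Qed.

End PowerSeries.

(** * The algebra A_Lambda as a deformation of A_0 *)

Definition AL_gen (T : Type) m (w : 'I_m -> T) (Ep Em L : T)
    (x : option ('I_m + bool)) : T :=
  if x is Some y then A_gen w Ep Em y else L.

(** [mu] stands for i^n. In the module clause the volume element appears as a [foldr], the composite
    of the operators of its factors. *)
Record is_ALambda (C : fieldType) (m : nat) (mu : C) (B : pzAlg C)
    (w : 'I_m -> B) (Ep Em L : B) : Prop := IsALambda {
  AL_generated : generated_by (AL_gen w Ep Em L);
  AL_commutator :
    Em * Ep = Ep * Em + (4%:R^-1 *: (1 : B) - mu *: (L * \prod_j w j));
  AL_clifford : clifford_family w;
  AL_plus : forall j, Ep * w j = - (w j * Ep);
  AL_minus : forall j, Em * w j = - (w j * Em);
  AL_central : forall x, L * x = x * L;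
  AL_action : forall (W : lmodType C) (ow : 'I_m -> W -> W) (op om ol : W -> W),
    (forall j, linear (ow j)) -> linear op -> linear om -> linear ol ->
    (forall j k v, ow j (ow k v) + ow k (ow j v) = v *+ 2 *+ (j == k)) ->
    (forall v, om (op v) = op (om v) +
      (4%:R^-1 *: v - mu *: ol (foldr ow v (index_enum 'I_m)))) ->
    (forall j v, op (ow j v) = - ow j (op v)) ->
    (forall j v, om (ow j v) = - ow j (om v)) ->
    (forall j v, ol (ow j v) = ow j (ol v)) ->
    (forall v, ol (op v) = op (ol v)) ->
    (forall v, ol (om v) = om (ol v)) ->
    exists a : action B W, [/\ forall j v, a (w j) v = ow j v,
      forall v, a Ep v = op v, forall v, a Em v = om v & forall v, a L v = ol v]
}.

Section Deformation.
Variables (C : fieldType) (m : nat) (mu : C).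
Variables (Cl : pzAlg C) (wc : 'I_m -> Cl) (s : alg_mor Cl Cl).
Hypotheses (om : odd m) (Clw : is_clifford wc) (sw : forall j, s (wc j) = - wc j)
  (sK : forall c, s (s c) = c).
Variables (A : pzAlg C) (w : 'I_m -> A) (Ep Em : A) (i : alg_mor Cl A).
Hypotheses (HA : is_A0 w Ep Em) (iw : forall j, i (wc j) = w j).
Variables (B : pzAlg C) (wB : 'I_m -> B) (EpB EmB L : B) (iB : alg_mor Cl B).
Hypotheses (HB : is_ALambda mu wB EpB EmB L) (iBw : forall j, iB (wc j) = wB j).
Local Notation mon := (pbw_mon Ep Em i).
Local Notation monB := (pbw_mon EpB EmB iB).
Local Notation P := (mu *: \prod_j wc j).

Let iP : i P = mu *: \prod_j w j.
Proof. by rewrite morZ mor_prod (eq_bigr _ (fun j _ => iw j)). Qed.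

Let iBP : iB P = mu *: \prod_j wB j.
Proof. by rewrite morZ mor_prod (eq_bigr _ (fun j _ => iBw j)). Qed.

Let sP : s P = - P.
Proof.
rewrite morZ mor_prod (eq_bigr _ (fun j _ => sw j)) clifford_volumeN //.
exact: scalerN.
Qed.

Let PC c : c * P = P * c.
Proof. by rewrite pz_mulAl pz_mulAr (clifford_volumeC Clw om). Qed.

(* E_- acts on A_0[[Lambda]] as E_- + Lambda D, where D is, up to sign, the
   divided difference in E_+: (f(E_+) - f(- E_+)) / (2 E_+). *)
Lemma dunkl_operator : exists D : A -> A, [/\ linear D,
    forall c a b, D (mon c a b) = if odd a then - mon (s c * P) a.-1 b else 0,
    forall j x, D (w j * x) = - (w j * D x)
  & forall x, D (Ep * x) = Ep * D x - i P * x].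
Proof.
(* This is the [v] term of [pbw_mon_minus] for v = - Lambda P, with Lambda removed: what E_- yields
   in A_Lambda beyond its value in A_0. *)
pose g a b c := if odd a then - mon (s c * P) a.-1 b else 0.
have gL a b : linear (g a b).
  move=> k c d; rewrite /g; case: ifP => _; last by rewrite scaler0 addr0.
  rewrite mor_linear mulrDl pz_mulAl (pbw_mon_linear Ep Em i a.-1 b).
  by rewrite opprD scalerN.
have [D [DL Dm]] := pbw_lift Clw sw sK HA iw gL.
have DD x y : D (x + y) = D x + D y by exact: (raddfD (linear_of DL)).
exists D; split=> // [j x|x].
  elim/(pbwW Clw sw HA iw): x => [c a b|x y IHx IHy].
    rewrite (pbw_mon_gen Ep Em iw) !Dm /g; case: (odd a); last by rewrite mulr0 oppr0.
    by rewrite morM sw !mulNr pbw_monN mulrN (pbw_mon_gen Ep Em iw) !opprK mulrA.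
  by rewrite mulrDr !DD IHx IHy mulrDr opprD.
elim/(pbwW Clw sw HA iw): x => [c a b|x y IHx IHy]; last first.
  by rewrite mulrDr !DD IHx IHy !mulrDr opprD addrACA.
rewrite (pbw_mon_plus Clw sw Em iw (A0_plus HA)) !Dm /g sK /=.
have -> : i P * mon c a b = mon (c * P) a b by rewrite PC /pbw_mon morM !mulrA.
case: ifPn => [/negPf oa|]; first by rewrite oa mulr0 sub0r.
(* For odd a the left side is zero, and the two terms on the right cancel because [P] changes sign
   under [s]. *)
rewrite negbK => oa; rewrite oa mulrN (pbw_mon_plus Clw sw Em iw (A0_plus HA)).
rewrite morM sK sP mulrN prednK ?odd_gt0 //.
by rewrite pbw_monN opprK subrr.
Qed.

Lemma pbw_section : exists sec : A -> B,
  linear sec /\ forall c a b, sec (mon c a b) = monB c a b.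
Proof. exact: (pbw_lift Clw sw sK HA iw (pbw_mon_linear EpB EmB iB)). Qed.

Variable D : A -> A.
Hypotheses (DL : linear D)
  (Dm : forall c a b, D (mon c a b) = if odd a then - mon (s c * P) a.-1 b else 0)
  (Dw : forall j x, D (w j * x) = - (w j * D x))
  (Dp : forall x, D (Ep * x) = Ep * D x - i P * x).

(** * The action of A_Lambda on A_0[[Lambda]] *)

Let op_gen (j : 'I_m) (f : pseries A) : pseries A := fun k => w j * f k.
Let op_plus (f : pseries A) : pseries A := fun k => Ep * f k.
Let op_minus (f : pseries A) : pseries A :=
  fun k => Em * f k + (if k is k'.+1 then D (f k') else 0).

Let psD (f g : pseries A) k : (f + g) k = f k + g k. Proof. by []. Qed.
Let psN (f : pseries A) k : (- f) k = - f k. Proof. by []. Qed.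
Let psZ c (f : pseries A) k : (c *: f) k = c *: f k. Proof. by []. Qed.
Let psMn (f : pseries A) l k : (f *+ l) k = f k *+ l.
Proof. by elim: l => // l IH; rewrite !mulrS psD IH. Qed.

Let DD x y : D (x + y) = D x + D y.
Proof. exact: (raddfD (linear_of DL)). Qed.
Let ps_sumE M (F : nat -> pseries A) k :
  (\sum_(l < M) F l) k = \sum_(l < M) F l k.
Proof.
elim: M => [|M IH]; first by rewrite !big_ord0.
by rewrite !big_ord_recr -IH.
Qed.
Let D0 : D 0 = 0. Proof. exact: linear0_of. Qed.

(** In degree one in Lambda, the commutator relation is exactly [Dp] and the anticommutation of E_-
    with the generators is exactly [Dw]. *)
Lemma ALambda_action : exists a : action B (pseries A),
  [/\ forall j f, a (wB j) f = op_gen j f, forall f, a EpB f = op_plus f,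
      forall f, a EmB f = op_minus f & forall f, a L f = ps_shift f].
Proof.
apply: (AL_action HB).
- by move=> j c f g; apply/funext => k; rewrite psD psZ /op_gen mulrDr pz_mulAr.
- by move=> c f g; apply/funext => k; rewrite psD psZ /op_plus mulrDr pz_mulAr.
- move=> c f g; apply/funext => k; rewrite psD psZ /op_minus psD psZ mulrDr pz_mulAr.
  by case: k => [|k]; rewrite ?addr0 // psD psZ DL scalerDr addrACA.
- exact: ps_shift_linear.
- move=> j k f; apply/funext => l; rewrite psD !psMn /op_gen !mulrA -mulrDl.
  by rewrite (A0_clifford HA) mulrnAl mulr_natl.
- move=> f; apply/funext => k; rewrite !psD psN !psZ /op_minus /op_plus.
  have fold r : foldr op_gen f r = fun k => (\prod_(j <- r) w j) * f k.
    elim: r => [|j r IH]; apply/funext => l; first by rewrite big_nil mul1r.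
    by rewrite /= IH /op_gen big_cons mulrA.
  rewrite mulrA (A0_commutator HA) mulrDl pz_mulAl mul1r mulrDr -!mulrA.
  rewrite -!addrA; congr (_ + _); case: k => [|k].
    by rewrite mulr0 /= scaler0 !add0r subr0 addr0.
  by rewrite Dp iP pz_mulAl /= fold addrCA.
- move=> j f; apply/funext => k.
  by rewrite psN /op_plus /op_gen mulrA (A0_plus HA) mulNr mulrA.
- move=> j f; apply/funext => k; rewrite psN /op_minus /op_gen mulrA (A0_minus HA).
  by rewrite mulNr -mulrA mulrDr opprD; case: k => [|k]; rewrite ?mulr0 ?oppr0 // Dw.
- by move=> j f; apply/funext => -[|k]; rewrite /ps_shift /op_gen ?mulr0.
- by move=> f; apply/funext => -[|k]; rewrite /ps_shift /op_plus ?mulr0.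
- move=> f; apply/funext => -[|[|k]]; rewrite /ps_shift /op_minus ?mulr0 ?addr0 //.
  by rewrite D0 addr0.
Qed.

Variable a : action B (pseries A).
Hypotheses (aw : forall j f, a (wB j) f = op_gen j f)
  (ap : forall f, a EpB f = op_plus f) (am : forall f, a EmB f = op_minus f)
  (aL : forall f, a L f = ps_shift f).

Variable sec : A -> B.
Hypotheses (secL : linear sec) (secm : forall c a b, sec (mon c a b) = monB c a b).

Let secD x y : sec (x + y) = sec x + sec y.
Proof. exact: (raddfD (linear_of secL)). Qed.
Let secN x : sec (- x) = - sec x.
Proof. exact: (raddfN (linear_of secL)). Qed.
Let secZ c x : sec (c *: x) = c *: sec x.
Proof. exact: (linearZ_LR (linear_of secL)). Qed.
Let sec0 : sec 0 = 0.
Proof. exact: linear0_of. Qed.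

Let sec1 : sec 1 = 1.
Proof. by have := secm 1 0 0; rewrite /pbw_mon !mor1 !mulr1. Qed.

Lemma sec_gen j x : sec (w j * x) = wB j * sec x.
Proof.
elim/(pbwW Clw sw HA iw): x => [c b d|x y IHx IHy].
  by rewrite (pbw_mon_gen Ep Em iw) !secm (pbw_mon_gen EpB EmB iBw).
by rewrite mulrDr !secD mulrDr IHx IHy.
Qed.

Lemma sec_plus x : sec (Ep * x) = EpB * sec x.
Proof.
elim/(pbwW Clw sw HA iw): x => [c b d|x y IHx IHy].
  rewrite (pbw_mon_plus Clw sw Em iw (A0_plus HA)) !secm.
  by rewrite (pbw_mon_plus Clw sw EmB iBw (AL_plus HB)).
by rewrite mulrDr !secD mulrDr IHx IHy.
Qed.

(** Both sides come from [pbw_mon_minus]; the A_Lambda version has one more term, which is the image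
    of [Dm] times [L]. *)
Lemma sec_minus x : EmB * sec x = sec (Em * x) + L * sec (D x).
Proof.
elim/(pbwW Clw sw HA iw): x => [c b d|x y IHx IHy]; last first.
  by rewrite secD !mulrDr IHx IHy DD !secD mulrDr addrACA.
have eu : EpB * (4%:R^-1 *: (1 : B)) = 4%:R^-1 *: (1 : B) * EpB.
  by rewrite pz_mulAl pz_mulAr mul1r mulr1.
have EE : EmB * EpB = EpB * EmB + (4%:R^-1 *: (1 : B) + - (L * iB P)).
  by rewrite (AL_commutator HB) iBP pz_mulAr.
have ev : EpB * - (L * iB P) = - (- (L * iB P) * EpB).
  rewrite mulrN mulNr mulrA -(AL_central HB) -!mulrA.
  by rewrite (anticomm_sign Clw sw iBw (AL_plus HB)) sP morN mulNr mulrN.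
rewrite (A0_mon_minus Clw sw HA iw) secD secZ Dm !secm.
rewrite (pbw_mon_minus Clw sw iBw (AL_minus HB) EE eu ev) -addrA; congr (_ + _).
rewrite mulrDl mulrDl mulrDr -scaler_nat scalerA !pz_mulAl mul1r pz_mulAr mulrA.
congr (_ + _); case: (odd b); last by rewrite mulr0n !mul0r sec0 !mulr0.
rewrite mulr1n secN secm mulrN mulNr mulNr mulrN; congr (- _).
by rewrite /pbw_mon morM !mulrA (AL_central HB (iB (s c))).
Qed.

Let phi (x : B) : pseries A := a x (ps_const 1).

Let phi_linear : linear phi. Proof. exact: act_linearl. Qed.

Let phi1 : phi 1 = ps_const 1. Proof. exact: act1. Qed.

(** Centrality of [L] makes the action linear over Lambda, hence local in the degree. *)
Lemma act_shift x f : a x (ps_shift f) = ps_shift (a x f).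
Proof. by rewrite -!aL -!actM (AL_central HB). Qed.

Lemma act_local x k (f g : pseries A) :
  (forall l, (l <= k)%N -> f l = g l) -> a x f k = a x g k.
Proof. exact: (ps_shift_local (act_linearr a x) (act_shift x)). Qed.

Lemma act_exp_L l x f k : a (L ^+ l * x) f k = if (l <= k)%N then a x f (k - l)%N else 0.
Proof.
elim: l k => [|l IH] k; first by rewrite mul1r subn0.
by rewrite exprS -mulrA actM aL; case: k => [|k] //=; rewrite IH.
Qed.

Lemma exp_L_central k x : L ^+ k * x = x * L ^+ k.
Proof. by apply/esym/commrX; rewrite /GRing.comm (AL_central HB). Qed.

(** Modulo Lambda the operator D disappears, and every generator acts by left multiplication. *)
Lemma act_mod_L x f : a x f 0%N = phi x 0%N * f 0%N.
Proof.
rewrite /phi; elim/(AL_generated HB): x f => [|c x y IHx IHy|g x IH] f.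
- by rewrite !act1 mul1r.
- by rewrite !actDl !actZl !psD !psZ mulrDl pz_mulAl IHx IHy.
- rewrite !actM; case: g => [[j|[]]|] /=.
  + by rewrite !aw /op_gen IH mulrA.
  + by rewrite !ap /op_plus IH mulrA.
  + by rewrite !am /op_minus !addr0 IH mulrA.
  + by rewrite !aL mul0r.
Qed.

Let op_const (x : A) : [/\ forall j, op_gen j (ps_const x) = ps_const (w j * x)
  & op_plus (ps_const x) = ps_const (Ep * x)].
Proof. by split=> [j|]; apply/funext => -[|k]; rewrite /op_gen /op_plus /= ?mulr0. Qed.

(** An ordered monomial applies E_- first, to powers of E_- only, which D kills since a = 0 is even;
    E_+ and the Clifford part act without correction. *)
Lemma phi_sec x : phi (sec x) = ps_const x.
Proof.
elim/(pbwW Clw sw HA iw): x => [c b d|x y IHx IHy]; last first.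
  rewrite secD /phi actDl -!/(phi _) IHx IHy; apply/funext => -[|k] //.
  by rewrite psD addr0.
have aEm e : a (EmB ^+ e) (ps_const 1) = ps_const (Em ^+ e).
  elim: e => [|e IH]; first exact: act1.
  rewrite exprS actM IH am; apply/funext => -[|[|k]]; rewrite /op_minus /=.
  - by rewrite addr0 -exprS.
  - by rewrite mulr0 add0r -[Em ^+ e]mul1r -[1 * _]mulr1 -(mulrA 1)
      (_ : 1 * (Em ^+ e * 1) = mon 1 0 e) ?Dm // /pbw_mon mor1 expr0 !mulr1 !mul1r.
  - by rewrite mulr0 D0 addr0.
have aEp e x : a (EpB ^+ e) (ps_const x) = ps_const (Ep ^+ e * x).
  elim: e => [|e IH]; first by rewrite act1 mul1r.
  by rewrite exprS actM IH ap (op_const _).2 exprS mulrA.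
have ai e x : a (iB e) (ps_const x) = ps_const (i e * x).
  elim/(clifford_generated Clw): e => [|k y z IHy IHz|j y IH].
  - by rewrite !mor1 act1 mul1r.
  - rewrite !mor_linear actDl actZl IHy IHz mulrDl pz_mulAl.
    by apply/funext => -[|l] //; rewrite psD psZ /= scaler0 addr0.
  - by rewrite !morM iBw iw actM IH aw (op_const _).1 mulrA.
by rewrite secm /phi /pbw_mon !actM aEm aEp ai mulrA.
Qed.

(** * Inverting [phi] by truncated sums *)

Definition ps_lift (M : nat) (f : pseries A) : B := \sum_(k < M) L ^+ k * sec (f k).

Lemma ps_lift_linear M : linear (ps_lift M).
Proof.
move=> c f g; rewrite /ps_lift scaler_sumr -big_split; apply: eq_bigr => k _ /=.
by rewrite psD psZ secL mulrDr pz_mulAr.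
Qed.

Lemma ps_lift_local M f g : (forall k, (k < M)%N -> f k = g k) ->
  ps_lift M f = ps_lift M g.
Proof. by move=> fg; apply: eq_bigr => k _; rewrite fg. Qed.

Lemma ps_lift_shift M f : ps_lift M.+1 (ps_shift f) = L * ps_lift M f.
Proof.
rewrite /ps_lift big_ord_recl mul1r /= sec0 add0r mulr_sumr.
by apply: eq_bigr => k _; rewrite mulrA -exprS.
Qed.

Lemma phi_ps_lift M f k : phi (ps_lift M f) k = if (k < M)%N then f k else 0.
Proof.
have -> : phi (ps_lift M f) k = \sum_(l < M) (if l == k :> nat then f l else 0).
  rewrite /phi act_suml (ps_sumE M (fun l => a (L ^+ l * sec (f l)) (ps_const 1))).
  apply: eq_bigr => l _; rewrite act_exp_L -/(phi _) phi_sec /ps_const /= subn_eq0.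
  by case: ltngtP.
case: ifP => kM.
  rewrite (bigD1 (Ordinal kM)) //= eqxx big1 ?addr0 // => l lk.
  by rewrite ifN.
by rewrite big1 // => l _; case: eqP => // lk; rewrite -lk ltn_ord in kM.
Qed.

(** Induction along words. Multiplying by E_- or by Lambda may raise the degree by one, hence the
    bounds [N.+1]. *)
Lemma ps_lift_phi x : exists N, forall M, (N <= M)%N ->
  ps_lift M (phi x) = x /\ phi x M = 0.
Proof.
elim/(AL_generated HB): x => [|c x y [N IHx] [N' IHy]|g x [N IH]].
- exists 1 => -[//|M] _; rewrite phi1 /ps_lift big_ord_recl big1 => [|k _].
    by rewrite mul1r /= sec1 addr0.
  by rewrite /= sec0 mulr0.
- exists (maxn N N') => M; rewrite geq_max => /andP[/IHx[x1 x2] /IHy[y1 y2]].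
  by rewrite phi_linear ps_lift_linear x1 y1 psD psZ x2 y2 scaler0 addr0.
have phiM y : phi (y * x) = a y (phi x) by rewrite /phi actM.
case: g => [[j|[]]|] /=; rewrite phiM.
- exists N => M /IH[x1 x2]; rewrite aw /op_gen x2 mulr0; split=> //.
  rewrite -[in RHS]x1 mulr_sumr; apply: eq_bigr => k _.
  by rewrite sec_gen !mulrA exp_L_central.
- exists N => M /IH[x1 x2]; rewrite ap /op_plus x2 mulr0; split=> //.
  rewrite -[in RHS]x1 mulr_sumr; apply: eq_bigr => k _.
  by rewrite sec_plus !mulrA exp_L_central.
- exists N.+1 => -[//|M] MN; have [x1 x2] := IH _ MN; have [y1 y2] := IH _ (leqW MN).
  rewrite am; split; last by rewrite /op_minus y2 mulr0 x2 D0 addr0.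
  have -> : op_minus (phi x) =
      (fun k => Em * phi x k) + ps_shift (fun k => D (phi x k)).
    by apply/funext => -[|k].
  have LD : ps_lift M.+1 ((fun k => Em * phi x k) + ps_shift (fun k => D (phi x k))) =
     ps_lift M.+1 (fun k => Em * phi x k) + ps_lift M.+1 (ps_shift (fun k => D (phi x k))).
    exact: (raddfD (linear_of (ps_lift_linear M.+1))).
  rewrite LD ps_lift_shift -[in RHS]y1 /ps_lift [in RHS]mulr_sumr /=.
  (* The extra term k = M is zero because [phi x M = 0]; for this reason the vanishing is carried
     along in the induction. *)
  have -> : L * \sum_(k < M) L ^+ k * sec (D (phi x k)) =
      \sum_(k < M.+1) L ^+ k * (L * sec (D (phi x k))).
    rewrite big_ord_recr /= x2 D0 sec0 !mulr0 addr0 mulr_sumr.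
    by apply: eq_bigr => k _; rewrite !mulrA (AL_central HB).
  rewrite -big_split; apply: eq_bigr => k _ /=.
  by rewrite -mulrDr -sec_minus !mulrA exp_L_central.
- exists N.+1 => -[//|M] /IH[x1 x2]; rewrite aL /= x2; split=> //.
  by rewrite ps_lift_shift x1.
Qed.

(** * The transported product *)

Definition star (f g : pseries A) : pseries A := fun k => a (ps_lift k.+1 f) g k.

(** The extra terms of the lift carry [L ^+ l] with l > k, which cannot reach degree k; so one
    truncation serves all degrees below [M]. *)
Lemma star_ps_lift M f g k : (k < M)%N -> star f g k = a (ps_lift M f) g k.
Proof.
move=> /subnK <-; elim: (M - _)%N => [|d IH] //.
rewrite addSn /ps_lift big_ord_recr -/(ps_lift _ _) actDl psD -IH.
by rewrite act_exp_L leqNgt leq_addl addr0.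
Qed.

Lemma star_phi x g : star (phi x) g = a x g.
Proof.
have [N NP] := ps_lift_phi x; apply/funext => k.
rewrite (star_ps_lift (M := maxn N k.+1)) ?leq_maxr //.
by rewrite (NP _ _).1 ?leq_maxl.
Qed.

Lemma phiM x y : phi (x * y) = star (phi x) (phi y).
Proof. by rewrite star_phi /phi actM. Qed.

Lemma star_local k f f' g g' : (forall l, (l <= k)%N -> f l = f' l) ->
  (forall l, (l <= k)%N -> g l = g' l) -> star f g k = star f' g' k.
Proof.
by move=> ff gg; rewrite /star (@ps_lift_local _ f f') //; apply: act_local.
Qed.

Lemma starA : associative star.
Proof.
move=> f g h; apply/funext => k; set x := ps_lift k.+1 f; set y := ps_lift k.+1 g.
(* Up to degree k both bracketings are the action on [h] of one product in [B], so associativity is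
   inherited from [B]. *)
transitivity (a (x * y) h k).
  rewrite actM; apply: act_local => l lk.
  by rewrite (star_ps_lift (M := k.+1)).
rewrite -star_phi; apply: star_local => // l lk.
rewrite (star_ps_lift (M := k.+1)) // /phi actM.
by apply: act_local => l' l'l; rewrite -/(phi y) phi_ps_lift ltnS (leq_trans l'l).
Qed.

Lemma star_linearl g : ps_linear (star^~ g).
Proof.
apply: ps_linear_shift => [c f f'|f]; apply/funext => k.
  by rewrite /star ps_lift_linear (act_linearl a g).
by rewrite /star ps_lift_shift actM aL; case: k.
Qed.

Lemma star_linearr f : ps_linear (star f).
Proof.
apply: ps_linear_shift => [c g g'|g]; apply/funext => k.
  by rewrite /star (act_linearr a _).
rewrite /star act_shift; case: k => [|k] //=.
(* Degree k + 1 truncates at k + 2, one term more than degree k requires after the shift. *)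
by rewrite -(star_ps_lift (M := k.+2)).
Qed.

Lemma star_deformation : polynomial_deformation star.
Proof.
split=> [|x y].
  split; [exact: star_linearl|exact: star_linearr|exact: starA| |].
    exists (ps_const 1); split=> f; first by rewrite -phi1 star_phi act1.
    apply/funext => k; rewrite -phi1 /star -actM mulr1 -/(phi _) phi_ps_lift.
    by rewrite ltnSn.
  by move=> x y; rewrite -(phi_sec x) star_phi act_mod_L phi_sec.
(* The product of two constants is the image under [phi] of an element of [B], hence a
   polynomial. *)
have [N NP] := ps_lift_phi (sec x * sec y).
by exists N => k /NP[_]; rewrite phiM !phi_sec.
Qed.

Lemma iso_poly_part_phi : iso_poly_part star L (linear_of phi_linear).
Proof.
split=> [x y|f|||x].
- move=> /= xy; have [N NP] := ps_lift_phi x; have [N' NP'] := ps_lift_phi y.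
  rewrite -(NP (maxn N N') _).1 ?leq_maxl // -(NP' (maxn N N') _).1 ?leq_maxr //.
  by rewrite xy.
- split=> [[N fN]|[x <-]]; last first.
    by have [N NP] := ps_lift_phi x; exists N => k /NP[].
  exists (ps_lift N f); apply/funext => k; rewrite /= phi_ps_lift.
  by case: ltnP => // /fN.
- exact: phiM.
- exact: phi1.
- by rewrite /= ps_scale_Lambda /phi actM aL.
Qed.

Lemma phi_gen j : phi (wB j) = ps_const (w j).
Proof. by rewrite /phi aw; apply/funext => -[|k]; rewrite /op_gen /= (mulr1, mulr0). Qed.

Lemma phi_plus : phi EpB = ps_const Ep.
Proof. by rewrite /phi ap; apply/funext => -[|k]; rewrite /op_plus /= (mulr1, mulr0). Qed.

Lemma phi_minus : phi EmB = ps_const Em.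
Proof.
have -> : EmB = sec (mon 1 0 1) by rewrite secm /pbw_mon mor1 !mul1r expr1.
by rewrite phi_sec /pbw_mon mor1 !mul1r expr1.
Qed.

(** * Non-triviality *)

Lemma star_nontrivial (T : A -> C) : linear (T : A -> C^o) ->
    (forall x y, T (x * y) = T (y * x)) -> mu * T (\prod_j w j) != 0 ->
  nontrivial_deformation star.
Proof.
move=> TL TC T0 [th [/ps_linearW[thL thS] [th' thK th'K] thM th0]].
have TD x y : T (x + y) = T x + T y by exact: (raddfD (linear_of TL)).
have TN x : T (- x) = - T x by exact: (raddfN (linear_of TL)).
have TZ k x : T (k *: x) = k * T x by exact: (linearZ_LR (linear_of TL)).
have mul1E f g : ps_mul f g 1%N = f 0%N * g 1%N + f 1%N * g 0%N.
  by rewrite /ps_mul !big_ord_recl big_ord0 addr0.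
set e := th (ps_const 1).
have e1 : e 1%N = 0.
  (* An equivalence is not assumed to preserve the unit; its multiplicativity at the preimage of 1
     under [th] forces it. *)
  have : ps_mul e (ps_const 1) = ps_const 1.
    by rewrite -[X in ps_mul _ X]th'K -thM -phi1 star_phi act1 th'K.
  by move/(congr1 (fun f => f 1%N)); rewrite mul1E /= mulr0 add0r mulr1.
pose u := th (phi EpB); pose v := th (phi EmB).
have volE : phi (\prod_j wB j) = ps_const (\prod_j w j).
  pose c := \prod_j wc j; have ic : i c = mon c 0 0 by rewrite /pbw_mon !mulr1.
  have iBc : iB c = monB c 0 0 by rewrite /pbw_mon !mulr1.
  have -> : \prod_j w j = i c by rewrite mor_prod (eq_bigr _ (fun j _ => iw j)).
  have -> : \prod_j wB j = iB c by rewrite mor_prod (eq_bigr _ (fun j _ => iBw j)).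
  by rewrite iBc -secm phi_sec -ic.
have EE : ps_mul v u - ps_mul u v =
    4%:R^-1 *: e - mu *: ps_shift (th (ps_const (\prod_j w j))).
  rewrite -!thM -!phiM; have thB f g : th (f - g) = th f - th g.
    exact: (raddfB (linear_of thL)).
  have thZ k f : th (k *: f) = k *: th f by exact: (linearZ_LR (linear_of thL)).
  rewrite -thB -volE -thS -!thZ -thB /e -phi1; congr th.
  have phiB x y : phi (x - y) = phi x - phi y.
    exact: (raddfB (linear_of phi_linear)).
  have phiZ k x : phi (k *: x) = k *: phi x.
    exact: (linearZ_LR (linear_of phi_linear)).
  rewrite -phiB (AL_commutator HB) addrC addKr phiB !phiZ.
  by rewrite [phi (L * _)]/phi actM aL.
(* In degree one the left side is [v_0, u_1] + [v_1, u_0], which [T] kills. On the right [e]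
   contributes nothing, and [th] is the identity modulo Lambda, so - mu times the volume element
   remains. *)
have := congr1 (fun f => T (f 1%N)) EE.
rewrite /= !psD !psN !psZ /= e1 scaler0 add0r !mul1E th0 /=.
rewrite TD TN !TD (TC (v 0%N)) (TC (v 1%N)) addrC [X in _ + X]addrC addNr TN TZ.
by move=> /esym/eqP; rewrite oppr_eq0; apply/negP.
Qed.

End Deformation.

(** * The presented algebras *)

Section Relations.
Variables (R : realType) (n : nat).
Local Notation C := (complex R).
Local Notation m := (2 * n + 1)%N.

(** [S] may contain more than these relators, so that the centrality relators of A_Lambda are
    allowed as well. *)
Lemma A_rel_proj (F : algType C) (S : F -> Prop) (w : 'I_m -> F) (Ep Em L : F) :
    (forall x, A_rel w Ep Em L x -> S x) -> let q := quot_proj S in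
  [/\ clifford_family (q \o w),
      q Em * q Ep = q Ep * q Em +
        (4%:R^-1 *: (1 : quot_alg S) - 'i ^+ n *: (q L * \prod_j q (w j))),
      forall j, q Ep * q (w j) = - (q (w j) * q Ep)
    & forall j, q Em * q (w j) = - (q (w j) * q Em)].
Proof.
move=> AS q; have q0 x : A_rel w Ep Em L x -> q x = 0.
  by move=> /AS; apply: quot_proj_rel.
have qD x y : q (x + y) = q x + q y by exact: (rmorphD (quot_proj S)).
have qN x : q (- x) = - q x by exact: (rmorphN (quot_proj S)).
have qM x y : q (x * y) = q x * q y by exact: (rmorphM (quot_proj S)).
have q1 : q 1 = 1 by exact: (rmorph1 (quot_proj S)).
have qZ c x : q (c *: x) = c *: q x.
  exact: (linearZ_LR (linear_of (quot_proj_linear S))).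
have qMn x k : q (x *+ k) = q x *+ k by exact: (rmorphMn (quot_proj S)).
have qP : q (\prod_j w j) = \prod_j q (w j) by exact: (rmorph_prod (quot_proj S)).
(* The body of [q] is forgotten; only its morphism laws remain for rewriting. *)
move: q q0 qD qN qM q1 qZ qMn qP => q q0 qD qN qM q1 qZ qMn qP.
split=> [j k||j|j] /=; apply/eqP; rewrite -subr_eq0.
- by rewrite -q1 -!qMn -!qM -qD -qN -qD; apply/eqP/q0/A_clifford.
- have := q0 _ (A_commutator w Ep Em L).
  rewrite !(qD, qN, qM, qZ, q1) qP => EE; rewrite -oppr_eq0 -EE.
  by apply/eqP; rewrite !opprD !opprK -!addrA addrCA.
- by rewrite -!qM -!qN -qD; apply/eqP/q0/A_plus.
- by rewrite -!qM -!qN -qD; apply/eqP/q0/A_minus.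
Qed.

Lemma A_rel_act0 (F : algType C) (w : 'I_m -> F) (Ep Em L : F) (W : lmodType C)
    (a : alg_action F W) (ow : 'I_m -> W -> W) (op om ol : W -> W) :
    (forall j v, a (w j) v = ow j v) -> (forall v, a Ep v = op v) ->
    (forall v, a Em v = om v) -> (forall v, a L v = ol v) ->
    (forall j k v, ow j (ow k v) + ow k (ow j v) = v *+ 2 *+ (j == k)) ->
    (forall v, om (op v) = op (om v) +
      (4%:R^-1 *: v - 'i ^+ n *: ol (foldr ow v (index_enum 'I_m)))) ->
    (forall j v, op (ow j v) = - ow j (op v)) ->
    (forall j v, om (ow j v) = - ow j (om v)) ->
  forall r v, A_rel w Ep Em L r -> a r v = 0.
Proof.
move=> aw ap am aL oC EE pw mw r v; case=> [|j k|j|j]; rewrite !alg_actE.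
- have -> : (fun j => a (w j)) = ow by apply/funext => j; apply/funext => u.
  by rewrite !(ap, am, aL) EE opprD addrA subrr add0r opprB [- _ + _]addrC subrr.
- by rewrite !aw oC subrr.
- by rewrite !(ap, aw) pw subrr.
- by rewrite !(am, aw) mw subrr.
Qed.

Lemma is_A0_A_ : is_A0 (@A_omega R n 0) (A_Eplus n 0) (A_Eminus n 0).
Proof.
pose S0 := A_relators (n := n) (0 : C).
have [wC EE pw mw] := A_rel_proj (S := S0) (fun x h => h).
have L0 (F : algType C) (S : F -> Prop) (x y : quot_alg S) :
    y + ((4%:R : C)^-1 *: (1 : quot_alg S) - 'i ^+ n *: (quot_proj S (0 *: 1) * x))
    = y + (4%:R : C)^-1 *: (1 : quot_alg S).
  by rewrite scale0r (linear0_of (quot_proj_linear S)) mul0r scaler0 subr0.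
split; [|exact: wC|exact: (etrans EE (L0 _ S0 _ _))|exact: pw|exact: mw|].
- move=> P P1 PD PM; apply: (presented_generated P1 PD) => -[j|[]] x.
  + exact: (PM (inl j)).
  + exact: (PM (inr true)).
  + exact: (PM (inr false)).
- move=> W ow op om oL pL mL oC mp pw' mw'.
  pose h (x : 'I_m + bool) := A_gen ow op om x.
  have hL x : linear (h x) by case: x => [j|[]]; [exact: oL|exact: pL|exact: mL].
  have rel0 r v : S0 r -> free_action hL r v = 0.
    (* In A_0 the place of Lambda is taken by the scalar 0, which acts as the zero operator. *)
    apply: (A_rel_act0 (ow := ow) (op := op) (om := om) (ol := fun=> 0)).
    + by move=> j u; apply: (free_actionE hL (inl j)).
    + by move=> u; apply: (free_actionE hL (inr true)).
    + by move=> u; apply: (free_actionE hL (inr false)).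
    + by move=> u; rewrite scale0r alg_act0l.
    + exact: oC.
    + by move=> u; rewrite scaler0 subr0.
    + exact: pw'.
    + exact: mw'.
  exists (presented_action rel0); split=> [j v|v|v].
  + exact: (presented_actionE rel0 (inl j)).
  + exact: (presented_actionE rel0 (inr true)).
  + exact: (presented_actionE rel0 (inr false)).
Qed.

Lemma is_ALambda_ALambda : is_ALambda ('i ^+ n) (@ALambda_omega R n)
  (ALambda_Eplus R n) (ALambda_Eminus R n) (ALambda_Lambda R n).
Proof.
pose S0 := @ALambda_relators R n.
have [wC EE pw mw] := A_rel_proj (S := S0) (fun x => @ALambda_A R n _ _ _ _ _ x).
split; [|exact: EE|exact: wC|exact: pw|exact: mw| |].
- move=> P P1 PD PM; apply: (presented_generated P1 PD) => -[[j|[]]|] x.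
  + exact: (PM (Some (inl j))).
  + exact: (PM (Some (inr true))).
  + exact: (PM (Some (inr false))).
  + exact: (PM None).
- have central (F : algType C) (S : F -> Prop) (L : F) :
      (forall x, S (L * x - x * L)) -> forall y, quot_proj S L * y = y * quot_proj S L.
    move=> SL; elim/quot_piW => x; rewrite -!/(quot_proj S x).
    apply/eqP; rewrite -subr_eq0 -!rmorphM -rmorphB.
    exact/eqP/quot_proj_rel/SL.
  by apply: (central _ S0) => x; apply: ALambda_central.
- move=> W ow op om ol oL pL mL lL oC mp pw' mw' lw lp lm.
  pose h (x : option ('I_m + bool)) := AL_gen ow op om ol x.
  have hL x : linear (h x).
    by case: x => [[j|[]]|]; [exact: oL|exact: pL|exact: mL|exact: lL].
  have hC x v : ol (h x v) = h x (ol v).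
    by case: x => [[j|[]]|]; [exact: lw|exact: lp|exact: lm|].
  (* Centrality relators involve arbitrary elements of the free algebra, while [hC] covers
     generators only; induction along words bridges the gap. *)
  have central (F : algType C) (gn : option ('I_m + bool) -> F) (a : alg_action F W) :
      (forall P : F -> Prop, P 1 -> (forall c x y, P x -> P y -> P (c *: x + y)) ->
       (forall g x, P x -> P (gn g * x)) -> forall x, P x) ->
      (forall x v, a (gn x) v = h x v) ->
      forall x v, a (gn None * x - x * gn None) v = 0.
    move=> genW ah x v; rewrite !alg_actE !ah -[h None]/ol.
    apply/eqP; rewrite subr_eq0; apply/eqP.
    elim/genW: x v => [|c x y IHx IHy|g x IH] v.
    - by rewrite !alg_act1.
    - by rewrite !(alg_actDl, alg_actZl) lL IHx IHy.
    - by rewrite !alg_actM !ah hC IH.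
  have rel0 r v : S0 r -> free_action hL r v = 0.
    case=> [x|x]; last by apply: central; [exact: free_algW|exact: free_actionE].
    apply: (A_rel_act0 (ow := ow) (op := op) (om := om) (ol := ol)).
    + by move=> j u; apply: (free_actionE hL (Some (inl j))).
    + by move=> u; apply: (free_actionE hL (Some (inr true))).
    + by move=> u; apply: (free_actionE hL (Some (inr false))).
    + by move=> u; apply: (free_actionE hL None).
    + exact: oC.
    + exact: mp.
    + exact: pw'.
    + exact: mw'.
  exists (presented_action rel0); split=> [j v|v|v|v].
  + exact: (presented_actionE rel0 (Some (inl j))).
  + exact: (presented_actionE rel0 (Some (inr true))).
  + exact: (presented_actionE rel0 (Some (inr false))).
  + exact: (presented_actionE rel0 None).
Qed.

Lemma cliffWeyl_rel_proj (F : algType C) (S : F -> Prop) (w : 'I_m -> F) (p q : F) :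
    (forall x, cliffWeyl_rel w p q x -> S x) -> let r := quot_proj S in
  [/\ clifford_family (r \o w), r p * r q = r q * r p + 1,
      forall j, r (w j) * r p = - (r p * r (w j))
    & forall j, r (w j) * r q = - (r q * r (w j))].
Proof.
move=> AS r; have r0 x : cliffWeyl_rel w p q x -> r x = 0.
  by move=> /AS; apply: quot_proj_rel.
have rD x y : r (x + y) = r x + r y by exact: (rmorphD (quot_proj S)).
have rN x : r (- x) = - r x by exact: (rmorphN (quot_proj S)).
have rM x y : r (x * y) = r x * r y by exact: (rmorphM (quot_proj S)).
have r1 : r 1 = 1 by exact: (rmorph1 (quot_proj S)).
have rMn x k : r (x *+ k) = r x *+ k by exact: (rmorphMn (quot_proj S)).
move: r r0 rD rN rM r1 rMn => r r0 rD rN rM r1 rMn.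
split=> [j k||j|j] /=; apply/eqP; rewrite -subr_eq0.
- by rewrite -r1 -!rMn -!rM -rD -rN -rD; apply/eqP/r0/cliffWeyl_clifford.
- by rewrite opprD addrA -r1 -!rM -!rN -!rD; apply/eqP/r0/cliffWeyl_weyl.
- by rewrite -!rM -!rN -rD; apply/eqP/r0/cliffWeyl_omega_p.
- by rewrite -!rM -!rN -rD; apply/eqP/r0/cliffWeyl_omega_q.
Qed.

Lemma cliffWeyl_rel_act0 (F : algType C) (w : 'I_m -> F) (p q : F)
    (W : lmodType C) (a : alg_action F W) (ow : 'I_m -> W -> W) (op oq : W -> W) :
    (forall j v, a (w j) v = ow j v) -> (forall v, a p v = op v) ->
    (forall v, a q v = oq v) ->
    (forall j k v, ow j (ow k v) + ow k (ow j v) = v *+ 2 *+ (j == k)) ->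
    (forall v, op (oq v) = oq (op v) + v) ->
    (forall j v, ow j (op v) = - op (ow j v)) ->
    (forall j v, ow j (oq v) = - oq (ow j v)) ->
  forall r v, cliffWeyl_rel w p q r -> a r v = 0.
Proof.
move=> aw ap aq oC EE pw qw r v; case=> [j k||j|j]; rewrite !alg_actE.
- by rewrite !aw oC subrr.
- by rewrite !(ap, aq) EE [X in X - v]addrAC subrr add0r subrr.
- by rewrite !(ap, aw) pw subrr.
- by rewrite !(aq, aw) qw subrr.
Qed.

(** The factors 1/2 invert p = 2 E_-, q = 2 E_+ and turn [p, q] = 1 into [E_-, E_+] = 1/4. *)
Lemma is_A0_cliffWeyl : is_A0 (@cliffWeyl_omega R n)
  (2%:R^-1 *: cliffWeyl_q R n) (2%:R^-1 *: cliffWeyl_p R n).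
Proof.
have n2 : 2%:R != 0 :> C by rewrite pnatr_eq0.
have h4 : 4%:R^-1 = 2%:R^-1 * 2%:R^-1 :> C by rewrite -invfM -natrM.
pose S0 := @cliffWeyl_relators R n.
have [wC EE pw qw] := cliffWeyl_rel_proj (S := S0) (fun x h => h).
have relE (B : pzAlg C) (w : 'I_m -> B) (p q : B) : p * q = q * p + 1 ->
    (forall j, w j * p = - (p * w j)) -> (forall j, w j * q = - (q * w j)) ->
    [/\ (2%:R^-1 *: p) * (2%:R^-1 *: q) =
          (2%:R^-1 *: q) * (2%:R^-1 *: p) + 4%:R^-1 *: (1 : B),
        forall j, (2%:R^-1 *: p) * w j = - (w j * (2%:R^-1 *: p))
      & forall j, (2%:R^-1 *: q) * w j = - (w j * (2%:R^-1 *: q))].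
  move=> pq wp wq; split=> [|j|j]; rewrite !pz_mulAl !pz_mulAr.
  - by rewrite !scalerA -h4 pq scalerDr.
  - by rewrite wp scalerN opprK.
  - by rewrite wq scalerN opprK.
have [EE' pw' qw'] := relE _ _ _ _ EE pw qw.
split; [|exact: wC|exact: EE'|exact: qw'|exact: pw'|].
- move=> P P1 PD PM.
  have PZ c x : P x -> P (c *: x).
    move=> Px; have P0 : P 0 by rewrite -(addNr 1) -scaleN1r; apply: PD.
    by rewrite -[_ *: _]addr0; apply: PD.
  have P2 (x y : cliffWeyl R n) : P ((2%:R^-1 *: x) * y) -> P (x * y).
    by move=> /(PZ 2%:R); rewrite pz_mulAl scalerA divff // scale1r.
  apply: (presented_generated P1 PD) => -[j|[]] x Px.
  + exact: (PM (inl j)).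
  + by apply: P2; apply: (PM (inr false)).
  + by apply: P2; apply: (PM (inr true)).
- move=> W ow op om oL pL mL oC mp pw'' mw''.
  have L2 (f : W -> W) : linear f -> linear (fun v => 2%:R *: f v).
    by move=> fL c u v; rewrite fL scalerDr !scalerA mulrC.
  (* In this presentation [inr true] is p and [inr false] is q, so the operators of E_- and E_+
     enter in swapped positions. *)
  pose h (x : 'I_m + bool) :=
    A_gen ow (fun v => 2%:R *: om v) (fun v => 2%:R *: op v) x.
  have hL x : linear (h x) by case: x => [j|[]] //=; apply: L2.
  have Z (f : W -> W) : linear f -> forall c v, f (c *: v) = c *: f v.
    by move=> fL; apply: (linearZ_LR (linear_of fL)).
  have rel0 r v : S0 r -> free_action hL r v = 0.
    apply: (cliffWeyl_rel_act0 (ow := ow) (op := h (inr true)) (oq := h (inr false))).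
    + by move=> j u; apply: (free_actionE hL (inl j)).
    + by move=> u; apply: (free_actionE hL (inr true)).
    + by move=> u; apply: (free_actionE hL (inr false)).
    + exact: oC.
    + move=> u; rewrite /= !Z // mp !scalerDr !scalerA; congr (_ + _).
      by rewrite -natrM mulfV ?scale1r // pnatr_eq0.
    + by move=> j u; rewrite /= Z // mw'' scalerN opprK.
    + by move=> j u; rewrite /= Z // pw'' scalerN opprK.
  exists (presented_action rel0); split=> [j v|v|v].
  + exact: (presented_actionE rel0 (inl j)).
  + rewrite actZl (presented_actionE rel0 (inr false)) /= scalerA mulVf //.
    exact: scale1r.
  + rewrite actZl (presented_actionE rel0 (inr true)) /= scalerA mulVf //.
    exact: scale1r.
Qed.

End Relations.

(** * Proof of the theorem from the abstract presentations *)

Lemma deformation_of_ALambda (C : numClosedFieldType) n (A : pzAlg C)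
    (w : 'I_(2 * n + 1) -> A) (Ep Em : A) (B : pzAlg C)
    (wB : 'I_(2 * n + 1) -> B) (EpB EmB L : B) :
    is_A0 w Ep Em -> is_ALambda ('i ^+ n) wB EpB EmB L ->
  exists star : pseries A -> pseries A -> pseries A,
    [/\ polynomial_deformation star, nontrivial_deformation star
      & exists phi : {linear B -> pseries A},
        [/\ iso_poly_part star L phi, forall j, phi (wB j) = ps_const (w j),
          phi EpB = ps_const Ep & phi EmB = ps_const Em]].
Proof.
move=> HA HB; have om : odd (2 * n + 1) by rewrite addn1 /= mul2n odd_double.
have [Cl [wc Clw]] := presented_clifford C (2 * n + 1).
have [s [sw sK]] := clifford_sign Clw.
have [i iw] := clifford_hom Clw (A0_clifford HA).
have [iB iBw] := clifford_hom Clw (AL_clifford HB).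
have [t [tL tC ts t0]] := clifford_trace Clw sw sK.
have [T [TL TC Tt]] := A0_trace Clw sw sK HA iw tL tC ts.
have [D [DL Dm Dw Dp]] := dunkl_operator ('i ^+ n) om Clw sw sK HA iw.
have [a [aw ap am aL]] := ALambda_action HA iw HB DL Dw Dp.
have [sec [secL secm]] := pbw_section Clw sw sK HA iw EpB EmB iB.
exists (star L a sec); split.
- exact: (star_deformation om Clw sw HA iw HB iBw DL Dm aw ap am aL secL secm).
- apply: (star_nontrivial om Clw sw HA iw HB iBw DL Dm aw ap am aL secL secm TL TC).
  rewrite mulf_neq0 ?expf_neq0 ?neq0Ci //.
  by rewrite -(eq_bigr _ (fun j _ => iw j)) -mor_prod Tt.
- eexists; split.
  + exact: (iso_poly_part_phi om Clw sw HA iw HB iBw DL Dm aw ap am aL secL secm).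
  + exact: (phi_gen aw).
  + exact: (phi_plus ap).
  + exact: (phi_minus Clw sw HA iw iBw DL Dm aw ap am secL secm).
Qed.

(** Left multiplications on [A'] satisfy the relations, so [A'] is a module over [A], and the orbit
    of 1 gives the morphism. *)
Lemma is_A0_hom (C : fieldType) m (A A' : pzAlg C) (w : 'I_m -> A) (Ep Em : A)
    (w' : 'I_m -> A') (Ep' Em' : A') : is_A0 w Ep Em -> is_A0 w' Ep' Em' ->
  exists f : alg_mor A A', forall x, f (A_gen w Ep Em x) = A_gen w' Ep' Em' x.
Proof.
move=> HA HA'.
have lmulL (x : A') : linear (fun v => x * v).
  by move=> c u v; rewrite mulrDr pz_mulAr.
have [|v|j v|j v|a [aw ap am]] := A0_action HA (fun j => lmulL (w' j)) (lmulL Ep') (lmulL Em').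
- by move=> j k v; rewrite !mulrA -mulrDl (A0_clifford HA') mulrnAl mulr_natl.
- by rewrite mulrA (A0_commutator HA') mulrDl pz_mulAl mul1r mulrA.
- by rewrite mulrA (A0_plus HA') mulNr mulrA.
- by rewrite mulrA (A0_minus HA') mulNr mulrA.
apply: (alg_mor_of_action (A0_generated HA) (a := a)) => -[j|[]] v /=.
- exact: aw.
- exact: ap.
- exact: am.
Qed.

Lemma is_A0_iso (C : fieldType) m (A A' : pzAlg C) (w : 'I_m -> A) (Ep Em : A)
    (w' : 'I_m -> A') (Ep' Em' : A') : is_A0 w Ep Em -> is_A0 w' Ep' Em' ->
  exists f : alg_mor A A',
    bijective f /\ forall x, f (A_gen w Ep Em x) = A_gen w' Ep' Em' x.
Proof.
move=> HA HA'; have [f fE] := is_A0_hom HA HA'; have [g gE] := is_A0_hom HA' HA.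
exists f; split=> //; exists g.
- elim/(A0_generated HA) => [|c x y IHx IHy|x y IH]; first by rewrite !mor1.
    by rewrite !mor_linear IHx IHy.
  by rewrite !morM IH fE gE.
- elim/(A0_generated HA') => [|c x y IHx IHy|x y IH]; first by rewrite !mor1.
    by rewrite !mor_linear IHx IHy.
  by rewrite !morM IH gE fE.
Qed.

Definition rmorph_of (K : comNzRingType) (B A : pzAlg K) (f : alg_mor B A) :
    {rmorphism B -> A} :=
  HB.pack (f : B -> A) (GRing.isLinear.Build K B A *:%R f (mor_linear f))
    (GRing.isMonoidMorphism.Build B A f (mor1 f, morM f)).

Theorem proposition6p8 (R : realType) (n : nat) :
  (exists f : {rmorphism cliffWeyl R n -> A_ n (0 : complex R)},
     [/\ scalable f, bijective f,
         forall j, f (cliffWeyl_omega R j) = A_omega 0 j,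
         f (cliffWeyl_p R n) = 2%:R *: A_Eminus n 0
       & f (cliffWeyl_q R n) = 2%:R *: A_Eplus n 0]) /\
  (exists star : pseries (A_ n (0 : complex R)) -> pseries (A_ n (0 : complex R)) ->
                 pseries (A_ n (0 : complex R)),
     [/\ polynomial_deformation star,
         nontrivial_deformation star
       & exists phi : {linear ALambda R n -> pseries (A_ n (0 : complex R))},
           [/\ iso_poly_part star (ALambda_Lambda R n) phi,
               forall j, phi (ALambda_omega R j) = ps_const (A_omega 0 j),
               phi (ALambda_Eplus R n) = ps_const (A_Eplus n 0)
             & phi (ALambda_Eminus R n) = ps_const (A_Eminus n 0)]]).
Proof.
split.
  have [f [fB fE]] := is_A0_iso (is_A0_cliffWeyl R n) (is_A0_A_ R n).
  have n2 : 2%:R != 0 :> complex R by rewrite pnatr_eq0.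
  have f2 x y : f (2%:R^-1 *: x) = y -> f x = 2%:R *: y.
    by move=> <-; rewrite -morZ scalerA divff // scale1r.
  exists (rmorph_of f); split.
  - exact: (morZ f).
  - exact: fB.
  - by move=> j; apply: (fE (inl j)).
  - exact: (f2 _ _ (fE (inr false))).
  - exact: (f2 _ _ (fE (inr true))).
exact: (@deformation_of_ALambda (complex R) n (A_ n 0) _ _ _ (ALambda R n)
  _ _ _ _ (is_A0_A_ R n) (is_ALambda_ALambda R n)).
Qed.
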